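(* Let \[\mathfrak{d}_{00}=\Big\{\mathbf{x}\in\ell_\infty:\limsup_{n\rightarrow\infty}\frac{|\{k\leq n:\mathbf{x}(k)\neq0\}|}{n}=0\Big\}\] and \[\mathfrak{d}_0=\Big\{\mathbf{x}\in\ell_\infty:\limsup_{n\rightarrow\infty}\frac{|\{k\leq n:|\mathbf{x}(k)|\geq\epsilon\}|}{n}=0\text{ for each }\epsilon>0\Big\}.\] Then: (1) $\mathfrak{d}_{00}$ is an ideal in $\ell_\infty$ and $\mathfrak{d}_0$ is a closed ideal in $\ell_\infty$. (2) $\mathfrak{d}_{00}$ is dense in $\mathfrak{d}_0$. (3) Neither $\mathfrak{d}_{00}$ nor $\mathfrak{d}_0$ is unital. (4) $\mathfrak{d}_{00}$ and $\mathfrak{d}_0$ are isometrically isomorphic to $C_{00}(Y)$ and $C_0(Y)$, respectively, for the subspace \[Y=\bigcup\Big\{\mathrm{cl}_{\beta\mathbb{N}}A:A\subseteq\mathbb{N}\text{ and }\limsup_{n\rightarrow\infty}\frac{|A\cap\{1,\ldots,n\}|}{n}=0\Big\}\] of $\beta\mathbb{N}$. (5) $\mathfrak{d}_{00}$ contains a copy of the normed algebra $\bigoplus_{n=1}^\infty\ell_\infty$. (6) $\mathfrak{d}_{00}/c_{00}$ contains a copy of the algebra $\bigoplus_{i<2^\omega}\frac{\ell_\infty}{c_{00}}$. (7) $\mathfrak{d}_0/c_0$ contains a copy of the normed algebra $\bigoplus_{i<2^\omega}\frac{\ell_\infty}{c_0}$.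
   Context: $\mathbb{N}$ is the set of positive integers with the discrete topology and $\beta\mathbb{N}$ is its Stone–Čech compactification; $|\cdot|$ applied to a set denotes cardinality. $\ell_\infty$ is the normed algebra of bounded real sequences (pointwise operations, supremum norm), $c_0$ is the set of real sequences converging to $0$, and $c_{00}$ the set of real sequences with only finitely many non-zero terms. The quotients by $c_0$ carry the quotient norm. For a space $Y$, $C_{00}(Y)$ is the normed algebra (supremum norm) of bounded continuous $f:Y\to\mathbb{R}$ with compact support, and $C_0(Y)$ that of bounded continuous $f:Y\to\mathbb{R}$ with $|f|^{-1}([1/n,\infty))$ compact for each positive integer $n$. ''Isometrically isomorphic'' means by an isometric algebra isomorphism. An algebra is unital if it has a multiplicative unit element. For a collection $\{X_i:i\in I\}$ of algebras, $\bigoplus_{i\in I}X_i$ is the algebra of all families $\{x_i\}_{i\in I}$ with $x_i\in X_i$ and $x_i=0$ for all but finitely many $i$, with component-wise operations; if the $X_i$ are normed it carries the norm $\sup_{i\in I}\|x_i\|_{X_i}$. The index set $i<2^\omega$ has the cardinality of the continuum. ''Contains a copy of the normed algebra $B$'' means contains a subalgebra isometrically isomorphic (as algebra) to $B$; ''contains a copy of the algebra $B$'' means contains a subalgebra isomorphic as an algebra to $B$. *)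

(* Defs.v *)
From HB Require Import structures.
From mathcomp Require Import all_boot all_order all_algebra.
From mathcomp Require Import all_classical all_reals.
From mathcomp Require Import topology normedtype sequences.
From mathcomp Require Import lra.

Set Implicit Arguments.
Unset Strict Implicit.
Unset Printing Implicit Defensive.

Import Order.TTheory GRing.Theory Num.Theory.
Import numFieldNormedType.Exports.

Local Open Scope classical_set_scope.
Local Open Scope ring_scope.

(* Algebras over R without a unit: the ring structures of ssralg all have a    *)
(* multiplicative unit, which most of the algebras considered here lack.       *)
HB.mixin Record Lmodule_isNUAlgebra (R : pzRingType) A of GRing.Lmodule R A := {
  amul : A -> A -> A;
  amulA : associative amul;
  amulDl : left_distributive amul +%R;
  amulDr : right_distributive amul +%R;
  amulZl : forall (a : R) x y, amul (a *: x) y = a *: amul x y;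
  amulZr : forall (a : R) x y, amul x (a *: y) = a *: amul x y
}.

#[short(type="nuAlgType")]
HB.structure Definition NUAlgebra (R : pzRingType) :=
  {A of GRing.Lmodule R A & Lmodule_isNUAlgebra R A}.

Notation "x ** y" := (amul x y) (at level 40, left associativity) : ring_scope.

HB.mixin Record NUAlgebra_isNormed (R : numFieldType) A
    of NormedModule R A & NUAlgebra R A := {
  ler_norm_amul : forall x y : A, `|x ** y| <= `|x| * `|y|
}.

#[short(type="normedNUAlgType")]
HB.structure Definition NormedNUAlgebra (R : numFieldType) :=
  {A of NormedModule R A & NUAlgebra R A & NUAlgebra_isNormed R A}.

Section AlgebraNotions.
Variable R : realType.
Implicit Types A B : nuAlgType R.

Definition is_subalgebra A (S : set A) :=
  [/\ S 0, forall (a : R) x y, S x -> S y -> S (a *: x + y) &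
      forall x y, S x -> S y -> S (x ** y)].

Definition is_ideal A (I : set A) :=
  [/\ I 0, forall (a : R) x y, I x -> I y -> I (a *: x + y) &
      forall x y, I y -> I (x ** y) /\ I (y ** x)].

Definition unital A := exists e : A, forall x : A, e ** x = x /\ x ** e = x.

Definition algebra_morphism A B (f : A -> B) :=
  linear f /\ {morph f : x y / x ** y}.

Definition isomorphic A B :=
  exists f : A -> B, algebra_morphism f /\ bijective f.

Definition isometrically_isomorphic (A B : normedNUAlgType R) :=
  exists f : A -> B,
    [/\ algebra_morphism f, bijective f & forall x, `|f x| = `|x|].

Record subalgebra A := Subalgebra {
  subalgebra_set :> set A;
  subalgebraP : is_subalgebra subalgebra_set }.

Record ideal A := Ideal {
  ideal_set :> set A;
  idealP : is_ideal ideal_set }.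

Record closed_ideal (A : normedNUAlgType R) := ClosedIdeal {
  closed_ideal_ideal :> ideal A;
  closed_idealP : closed (closed_ideal_ideal : set A) }.

Lemma ideal_is_subalgebra A (I : ideal A) : is_subalgebra I.
Proof. by case: I => I [I0 IL IM]; split => // x y _ /(IM x)[]. Qed.

Definition ideal_subalgebra A (I : ideal A) : subalgebra A :=
  Subalgebra (ideal_is_subalgebra I).

End AlgebraNotions.

Section SubalgebraType.
Variables (R : realType) (A : nuAlgType R) (S : subalgebra A).

Definition subalg := set_type S.

HB.instance Definition _ := SubChoice.on subalg.

Lemma subalg_submod_closed : subsemimod_closed (mem (S : set A)).
Proof.
have [S0 SL _] := subalgebraP S.
split; first split; first exact/mem_set.
  by move=> x y /set_mem Sx /set_mem Sy; apply/mem_set; rewrite -[x]scale1r; exact: SL.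
by move=> a x /set_mem Sx; apply/mem_set; rewrite -[_ *: x]addr0; exact: SL.
Qed.

HB.instance Definition _ :=
  GRing.SubChoice_isSubLmodule.Build R A _ subalg subalg_submod_closed.

Lemma val_subalgD (x y : subalg) : val (x + y) = val x + val y.
Proof. exact: raddfD. Qed.

Lemma val_subalgZ (a : R) (x : subalg) : val (a *: x) = a *: val x.
Proof. exact: linearZ. Qed.

Lemma val_subalg0 : val (0 : subalg) = 0.
Proof. exact: raddf0. Qed.

Lemma subalg_mul_proof (x y : subalg) : val x ** val y \in (S : set A).
Proof.
have [_ _ SM] := subalgebraP S.
by apply/mem_set/SM; apply/set_mem; exact: valP.
Qed.

Definition subalg_mul (x y : subalg) : subalg :=
  exist (fun z => z \in (S : set A)) _ (subalg_mul_proof x y).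

Lemma val_subalg_mul x y : val (subalg_mul x y) = val x ** val y.
Proof. by []. Qed.

Lemma subalg_mulA : associative subalg_mul.
Proof. by move=> x y z; apply: val_inj; rewrite !val_subalg_mul amulA. Qed.

Lemma subalg_mulDl : left_distributive subalg_mul +%R.
Proof.
by move=> x y z; apply: val_inj; rewrite val_subalgD !val_subalg_mul val_subalgD amulDl.
Qed.

Lemma subalg_mulDr : right_distributive subalg_mul +%R.
Proof.
by move=> x y z; apply: val_inj; rewrite val_subalgD !val_subalg_mul val_subalgD amulDr.
Qed.

Lemma subalg_mulZl (a : R) x y : subalg_mul (a *: x) y = a *: subalg_mul x y.
Proof. by apply: val_inj; rewrite val_subalgZ !val_subalg_mul val_subalgZ amulZl. Qed.

Lemma subalg_mulZr (a : R) x y : subalg_mul x (a *: y) = a *: subalg_mul x y.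
Proof. by apply: val_inj; rewrite val_subalgZ !val_subalg_mul val_subalgZ amulZr. Qed.

HB.instance Definition _ := Lmodule_isNUAlgebra.Build R subalg
  subalg_mulA subalg_mulDl subalg_mulDr subalg_mulZl subalg_mulZr.

Lemma val_subalgM (x y : subalg) : val (x ** y) = val x ** val y.
Proof. exact: val_subalg_mul. Qed.

End SubalgebraType.

Section NormedSubalgebraType.
Variables (R : realType) (A : normedNUAlgType R) (S : subalgebra A).

Definition subalg_norm (x : subalg S) : R := `|val x|.

Lemma subalg_normD x y : subalg_norm (x + y) <= subalg_norm x + subalg_norm y.
Proof. by rewrite /subalg_norm val_subalgD ler_normD. Qed.

Lemma subalg_normZ (a : R) x : subalg_norm (a *: x) = `|a| * subalg_norm x.
Proof. by rewrite /subalg_norm val_subalgZ normrZ. Qed.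

Lemma subalg_norm_eq0 x : subalg_norm x = 0 -> x = 0.
Proof. by move/normr0_eq0 => x0; apply: val_inj; rewrite x0 val_subalg0. Qed.

HB.instance Definition _ := Lmodule_isNormed.Build R (subalg S)
  subalg_normD subalg_normZ subalg_norm_eq0.

Lemma norm_subalg (x : subalg S) : `|x| = `|val x|.
Proof. by []. Qed.

Lemma subalg_normM (x y : subalg S) : `|x ** y| <= `|x| * `|y|.
Proof. by rewrite !norm_subalg val_subalgM ler_norm_amul. Qed.

HB.instance Definition _ := NUAlgebra_isNormed.Build R (subalg S) subalg_normM.

End NormedSubalgebraType.

Section Copies.
Variable R : realType.

Definition contains_copy (A B : nuAlgType R) :=
  exists S : subalgebra A, isomorphic (subalg S) B.

Definition contains_normed_copy (A B : normedNUAlgType R) :=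
  exists S : subalgebra A, isometrically_isomorphic (subalg S) B.

End Copies.

Section QuotientAlgebra.
Local Open Scope quotient_scope.
Variables (R : realType) (A : nuAlgType R) (I : ideal A).

Definition ideal_mem : {pred A} := fun x => `[< ideal_set I x >].

Lemma ideal_memP x : x \in ideal_mem <-> ideal_set I x.
Proof. by split => /asboolP. Qed.

Lemma ideal_zmod_closed : zmod_closed ideal_mem.
Proof.
have [I0 IL _] := idealP I; split; first exact/ideal_memP.
move=> x y /ideal_memP Ix /ideal_memP Iy; apply/ideal_memP.
by rewrite addrC -scaleN1r; exact: IL.
Qed.

HB.instance Definition _ := GRing.isZmodClosed.Build A ideal_mem ideal_zmod_closed.

Definition quot_alg : Type := Quotient.quot ideal_mem.

HB.instance Definition _ := GRing.Zmodule.on quot_alg.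
HB.instance Definition _ := generic_quotient.Quotient.on quot_alg.

Definition qproj (x : A) : quot_alg := \pi_quot_alg x.

Lemma qprojP x y : qproj x = qproj y <-> ideal_set I (x - y).
Proof.
rewrite -ideal_memP (Quotient.idealrBE ideal_mem x y).
by split=> /eqP.
Qed.

Lemma qproj_surj (u : quot_alg) : {x | qproj x = u}.
Proof. by exists (repr u); exact: reprK. Qed.

Lemma qprojD x y : qproj (x + y) = qproj x + qproj y.
Proof. exact: Quotient.pi_add. Qed.

Lemma qproj0 : qproj 0 = 0.
Proof. by apply: (addIr (qproj 0)); rewrite -qprojD !add0r. Qed.

Definition qscale (a : R) (u : quot_alg) : quot_alg := qproj (a *: repr u).

Lemma repr_qproj x : ideal_set I (repr (qproj x) - x).
Proof. by apply/qprojP; exact: reprK. Qed.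

Lemma qscaleE a x : qscale a (qproj x) = qproj (a *: x).
Proof.
have [I0 IL _] := idealP I.
apply/qprojP; rewrite -scalerBr -[_ *: _]addr0; apply: IL => //.
exact: repr_qproj.
Qed.

Lemma qscaleA a b u : qscale a (qscale b u) = qscale (a * b) u.
Proof. by have [x <-] := qproj_surj u; rewrite !qscaleE scalerA. Qed.

Lemma qscale1 : left_id 1 qscale.
Proof. by move=> u; have [x <-] := qproj_surj u; rewrite qscaleE scale1r. Qed.

Lemma qscaleDr : right_distributive qscale +%R.
Proof.
move=> a u v; have [x <-] := qproj_surj u; have [y <-] := qproj_surj v.
by rewrite -qprojD !qscaleE -qprojD scalerDr.
Qed.

Lemma qscaleDl u : {morph qscale^~ u : a b / a + b}.
Proof.
by move=> a b; have [x <-] := qproj_surj u; rewrite !qscaleE -qprojD scalerDl.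
Qed.

HB.instance Definition _ := GRing.Zmodule_isLmodule.Build R quot_alg
  qscaleA qscale1 qscaleDr qscaleDl.

Lemma qprojZ a x : qproj (a *: x) = a *: qproj x.
Proof. by rewrite -qscaleE. Qed.

Definition qmul (u v : quot_alg) : quot_alg := qproj (repr u ** repr v).

Lemma qmulE x y : qmul (qproj x) (qproj y) = qproj (x ** y).
Proof.
have [I0 IL IM] := idealP I.
have amulNr (a b : A) : a ** (- b) = - (a ** b).
  by rewrite -scaleN1r amulZr scaleN1r.
have amulNl (a b : A) : (- a) ** b = - (a ** b).
  by rewrite -scaleN1r amulZl scaleN1r.
apply/qprojP; set x' := repr _; set y' := repr _.
have -> : x' ** y' - x ** y = 1 *: (x' ** (y' - y)) + (x' - x) ** y.
  by rewrite scale1r amulDr amulDl amulNr amulNl addrA subrK.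
apply: IL; first exact: (IM _ _ (repr_qproj y)).1.
exact: (IM _ _ (repr_qproj x)).2.
Qed.

Lemma qmulA : associative qmul.
Proof.
move=> u v w; have [x <-] := qproj_surj u; have [y <-] := qproj_surj v.
by have [z <-] := qproj_surj w; rewrite !qmulE amulA.
Qed.

Lemma qmulDl : left_distributive qmul +%R.
Proof.
move=> u v w; have [x <-] := qproj_surj u; have [y <-] := qproj_surj v.
by have [z <-] := qproj_surj w; rewrite -qprojD !qmulE -qprojD amulDl.
Qed.

Lemma qmulDr : right_distributive qmul +%R.
Proof.
move=> u v w; have [x <-] := qproj_surj u; have [y <-] := qproj_surj v.
by have [z <-] := qproj_surj w; rewrite -qprojD !qmulE -qprojD amulDr.
Qed.

Lemma qmulZl (a : R) u v : qmul (a *: u) v = a *: qmul u v.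
Proof.
have [x <-] := qproj_surj u; have [y <-] := qproj_surj v.
by rewrite -qprojZ !qmulE -qprojZ amulZl.
Qed.

Lemma qmulZr (a : R) u v : qmul u (a *: v) = a *: qmul u v.
Proof.
have [x <-] := qproj_surj u; have [y <-] := qproj_surj v.
by rewrite -qprojZ !qmulE -qprojZ amulZr.
Qed.

HB.instance Definition _ := Lmodule_isNUAlgebra.Build R quot_alg
  qmulA qmulDl qmulDr qmulZl qmulZr.

Lemma qprojM x y : qproj (x ** y) = qproj x ** qproj y.
Proof. by rewrite -qmulE. Qed.

End QuotientAlgebra.

Section QuotientNorm.
Variables (R : realType) (A : normedNUAlgType R) (I : closed_ideal A).

Definition quot_norm (u : quot_alg I) : R :=
  inf [set `|x| | x in [set x | qproj I x = u]].

Lemma has_lbound_quot_norm u :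
  has_lbound [set `|x| | x in [set x | qproj I x = u]].
Proof. by exists 0 => _ [x _ <-]. Qed.

Lemma quot_norm_nonempty u : [set `|x| | x in [set x | qproj I x = u]] !=set0.
Proof. by have [x xu] := qproj_surj u; exists `|x|, x. Qed.

Lemma quot_norm_ge0 u : 0 <= quot_norm u.
Proof. by apply: lb_le_inf; [exact: quot_norm_nonempty|move=> _ [x _ <-]]. Qed.

Lemma quot_norm_le x : quot_norm (qproj I x) <= `|x|.
Proof. by apply: ge_inf; [exact: has_lbound_quot_norm|exists x]. Qed.

Lemma quot_norm_lt u (e : R) : 0 < e ->
  exists x, qproj I x = u /\ `|x| < quot_norm u + e.
Proof.
move=> e0; have hi : has_inf [set `|x| | x in [set x | qproj I x = u]].
  by split; [exact: quot_norm_nonempty|exact: has_lbound_quot_norm].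
by have [_ [x xu <-] xe] := inf_adherent e0 hi; exists x.
Qed.

Lemma quot_normD u v : quot_norm (u + v) <= quot_norm u + quot_norm v.
Proof.
apply/ler_addgt0Pl => e e0; have e20 : 0 < e / 2 by rewrite divr_gt0.
have [x [<- xe]] := quot_norm_lt u e20; have [y [<- ye]] := quot_norm_lt v e20.
rewrite -qprojD (le_trans (quot_norm_le _))// (le_trans (ler_normD _ _))//.
rewrite (le_trans (lerD (ltW xe) (ltW ye)))//.
by rewrite addrACA -splitr addrC.
Qed.

Lemma quot_normZ_le (a : R) u : quot_norm (a *: u) <= `|a| * quot_norm u.
Proof.
apply/ler_addgt0Pl => e e0; have a1 : 0 < `|a| + 1 by rewrite ltr_pwDr.
have [x [<- xe]] := quot_norm_lt u (divr_gt0 e0 a1).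
rewrite -qprojZ (le_trans (quot_norm_le _))// normrZ.
rewrite (le_trans (ler_wpM2l (normr_ge0 a) (ltW xe)))// mulrDr addrC lerD2r.
by rewrite mulrCA ler_piMr ?(ltW e0)// ler_pdivrMr// mul1r lerDl.
Qed.

Lemma quot_normZ (a : R) u : quot_norm (a *: u) = `|a| * quot_norm u.
Proof.
apply/eqP; rewrite eq_le quot_normZ_le/=.
have [->|a0] := eqVneq a 0; first by rewrite normr0 mul0r quot_norm_ge0.
have := quot_normZ_le a^-1 (a *: u).
by rewrite scalerA mulVf// scale1r normfV ler_pdivlMl// normr_gt0.
Qed.

Lemma quot_norm_eq0 u : quot_norm u = 0 -> u = 0.
Proof.
have [x <- x0] := qproj_surj u; rewrite -(qproj0 I); apply/qprojP.
rewrite subr0; apply: (@closed_idealP _ _ I x) => B /nbhs_ballP[e /= e0 eB].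
have [y [yx]] := quot_norm_lt (qproj I x) e0; rewrite x0 add0r => ye.
exists (x - y); split; first by apply/qprojP.
by apply: eB; rewrite -ball_normE /= subKr.
Qed.

HB.instance Definition _ := Lmodule_isNormed.Build R (quot_alg I)
  quot_normD quot_normZ quot_norm_eq0.

Lemma norm_quot_alg (u : quot_alg I) :
  `|u| = inf [set `|x| | x in [set x | qproj I x = u]].
Proof. by []. Qed.

Lemma quot_normM (u v : quot_alg I) : `|u ** v| <= `|u| * `|v|.
Proof.
change (quot_norm (u ** v) <= quot_norm u * quot_norm v).
rewrite leNgt; apply/negP => uv; pose b := quot_norm u; pose c := quot_norm v.
have b0 : 0 <= b := quot_norm_ge0 u; have c0 : 0 <= c := quot_norm_ge0 v.
pose k := b + c + 1; have k0 : 0 < k by rewrite ltr_pwDr// addr_ge0.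
pose e := Num.min 1 ((quot_norm (u ** v) - b * c) / k).
have e0 : 0 < e by rewrite lt_min ltr01 divr_gt0// subr_gt0.
have [x [xu xe]] := quot_norm_lt u e0; have [y [yv ye]] := quot_norm_lt v e0.
have : quot_norm (u ** v) < quot_norm (u ** v).
  rewrite -{1}xu -{1}yv -qprojM (le_lt_trans (quot_norm_le _))//.
  rewrite (le_lt_trans (ler_norm_amul _ _))//.
  apply: (@lt_le_trans _ _ ((b + e) * (c + e))); first exact: ltr_pM.
  have : e * k <= quot_norm (u ** v) - b * c.
    by rewrite -ler_pdivlMr// ge_min lexx orbT.
  rewrite lerBrDl; apply: le_trans.
  have ee : e * e <= e by rewrite ler_piMr ?(ltW e0)// ge_min lexx.
  by rewrite /k; move: ee; clearbody e b c; lra.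
by rewrite ltxx.
Qed.

HB.instance Definition _ := NUAlgebra_isNormed.Build R (quot_alg I) quot_normM.

End QuotientNorm.

Section RestrictIdeal.
Variables (R : realType).

Lemma restrict_is_ideal (A : nuAlgType R) (S : subalgebra A) (I : ideal A) :
  is_ideal [set x : subalg S | ideal_set I (val x)].
Proof.
have [I0 IL IM] := idealP I; rewrite /mkset; split; first by rewrite val_subalg0.
  by move=> a x y Ix Iy; rewrite val_subalgD val_subalgZ; exact: IL.
by move=> x y Iy; rewrite !val_subalgM; exact: IM.
Qed.

(* The quotient of S by I, for an ideal I of A contained in S, is the quotient  *)
(* by restrict_ideal S I.                                                      *)
Definition restrict_ideal A S I : ideal _ := Ideal (@restrict_is_ideal A S I).

Lemma restrict_closed (A : normedNUAlgType R) (S : subalgebra A)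
  (I : closed_ideal A) : closed (restrict_ideal S I : set (subalg S)).
Proof.
move=> x clx; apply: (@closed_idealP _ _ I (val x)) => B /nbhs_ballP[e /= e0 eB].
have [|y [Iy xy]] := clx (ball x e); first exact: nbhsx_ballx.
exists (val y); split => //; apply: eB; move: xy; rewrite -!ball_normE /=.
by rewrite norm_subalg val_subalgD -scaleN1r val_subalgZ scaleN1r.
Qed.

Definition restrict_closed_ideal (A : normedNUAlgType R) (S : subalgebra A)
  (I : closed_ideal A) : closed_ideal _ := ClosedIdeal (@restrict_closed A S I).

End RestrictIdeal.

Section SupFamily.
Variables (R : realType) (T : Type).
Implicit Types u v : T -> R.

Lemma sup_range_ub u t : has_ubound (range u) -> u t <= sup (range u).
Proof. by move=> ub; apply: ub_le_sup => //; exists t. Qed.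

Lemma sup_range_le u c : 0 <= c -> (forall t, u t <= c) -> sup (range u) <= c.
Proof.
move=> c0 uc; have [[t _]|T0] := pselect (exists t : T, True).
  by apply: ge_sup; [exists (u t), t|move=> _ [s _ <-]].
rewrite (_ : range u = set0) ?sup0//.
by apply/seteqP; split => // x [t]; case: T0; exists t.
Qed.

Lemma sup_range_ge0 u : (forall t, 0 <= u t) -> has_ubound (range u) ->
  0 <= sup (range u).
Proof.
move=> u0 ub; have [[t _]|T0] := pselect (exists t : T, True).
  exact: le_trans (u0 t) (sup_range_ub t ub).
rewrite (_ : range u = set0) ?sup0//.
by apply/seteqP; split => // x [t]; case: T0; exists t.
Qed.

Lemma sup_rangeZ (a : R) u : 0 <= a -> (forall t, 0 <= u t) ->
  has_ubound (range u) -> sup (range (fun t => a * u t)) = a * sup (range u).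
Proof.
move=> a0 u0 ub; apply/eqP; rewrite eq_le; apply/andP; split.
  apply: sup_range_le; first by rewrite mulr_ge0// sup_range_ge0.
  by move=> t; rewrite ler_wpM2l// sup_range_ub.
have uba : has_ubound (range (fun t => a * u t)).
  by exists (a * sup (range u)) => _ [t _ <-]; rewrite ler_wpM2l// sup_range_ub.
have ua0 t : 0 <= a * u t by rewrite mulr_ge0.
have [->|an0] := eqVneq a 0; first by rewrite mul0r; apply: sup_range_ge0 => [t|];
  [rewrite mul0r|exists 0 => _ [t _ <-]; rewrite mul0r].
have ap : 0 < a by rewrite lt_def an0.
rewrite -ler_pdivlMl//; apply: sup_range_le.
  by rewrite mulr_ge0 ?invr_ge0// sup_range_ge0.
by move=> t; rewrite ler_pdivlMl// (sup_range_ub t uba).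
Qed.

End SupFamily.

Lemma bounded_funP (R : realType) T (f : T -> R) :
  bounded_fun f <-> exists M, forall t, `|f t| <= M.
Proof.
split=> [[M [Mr fM]]|[M fM]].
  by exists (M + 1) => t; apply: fM => //; rewrite ltrDl.
exists M; split; first exact: num_real.
by move=> x Mx t _; exact: le_trans (fM t) (ltW Mx).
Qed.

Section BoundedFunctions.
Variables (R : realType) (T : Type).

Record bfun := BFun {
  bfun_fun :> T -> R;
  bfun_subproof : `[< bounded_fun bfun_fun >] }.

HB.instance Definition _ := [isSub for bfun_fun].
HB.instance Definition _ := [Choice of bfun by <:].

Lemma bfunE (f g : bfun) : (forall t, f t = g t) -> f = g.
Proof. by move=> fg; apply: val_inj; exact/funext. Qed.

Lemma bfun_bounded (f : bfun) : exists M, forall t, `|f t| <= M.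
Proof. by apply/bounded_funP/asboolP; exact: bfun_subproof. Qed.

Definition mk_bfun (f : T -> R) (fb : exists M, forall t, `|f t| <= M) : bfun :=
  BFun (asboolT ((bounded_funP f).2 fb)).

Lemma bfun_submod_closed :
  subsemimod_closed ((fun f => `[< bounded_fun f >]) : {pred T -> R}).
Proof.
split; first split.
- by apply/asboolP/bounded_funP; exists 0 => t; rewrite normr0.
- move=> f g /asboolP/bounded_funP[M fM] /asboolP/bounded_funP[N gN].
  apply/asboolP/bounded_funP; exists (M + N) => t.
  by rewrite (le_trans (ler_normD _ _))// lerD.
move=> a f /asboolP/bounded_funP[M fM].
apply/asboolP/bounded_funP; exists (`|a| * M) => t.
by rewrite /= normrM ler_wpM2l.
Qed.

HB.instance Definition _ := GRing.SubChoice_isSubLmodule.Build R (T -> R) _ bfun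
  bfun_submod_closed.

Lemma bfunDE (f g : bfun) t : (f + g) t = f t + g t.
Proof. by []. Qed.

Lemma bfunZE (a : R) (f : bfun) t : (a *: f) t = a * f t.
Proof. by []. Qed.

Lemma bfun0E t : (0 : bfun) t = 0.
Proof. by []. Qed.

Lemma bfun_mul_bounded (f g : bfun) : exists M, forall t, `|f t * g t| <= M.
Proof.
have [M fM] := bfun_bounded f; have [N gN] := bfun_bounded g.
by exists (M * N) => t; rewrite normrM ler_pM.
Qed.

Definition bfun_mul (f g : bfun) : bfun := mk_bfun (bfun_mul_bounded f g).

Lemma bfun_mulA : associative bfun_mul.
Proof. by move=> f g h; apply: bfunE => t; exact: mulrA. Qed.

Lemma bfun_mulDl : left_distributive bfun_mul +%R.
Proof. by move=> f g h; apply: bfunE => t; exact: mulrDl. Qed.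

Lemma bfun_mulDr : right_distributive bfun_mul +%R.
Proof. by move=> f g h; apply: bfunE => t; exact: mulrDr. Qed.

Lemma bfun_mulZl (a : R) f g : bfun_mul (a *: f) g = a *: bfun_mul f g.
Proof. by apply: bfunE => t; rewrite bfunZE /= mulrA. Qed.

Lemma bfun_mulZr (a : R) f g : bfun_mul f (a *: g) = a *: bfun_mul f g.
Proof. by apply: bfunE => t; rewrite bfunZE; exact: mulrCA. Qed.

HB.instance Definition _ := Lmodule_isNUAlgebra.Build R bfun
  bfun_mulA bfun_mulDl bfun_mulDr bfun_mulZl bfun_mulZr.

Lemma bfunME (f g : bfun) t : (f ** g) t = f t * g t.
Proof. by []. Qed.

(* sup set0 = 0, hence this is a norm also when T is empty. *)
Definition bfun_norm (f : bfun) : R := sup (range (fun t => `|f t|)).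

Lemma bfun_has_ubound (f : bfun) : has_ubound (range (fun t => `|f t|)).
Proof. by have [M fM] := bfun_bounded f; exists M => _ [t _ <-]. Qed.

Lemma ler_bfun_norm (f : bfun) t : `|f t| <= bfun_norm f.
Proof. exact: (sup_range_ub t (bfun_has_ubound f)). Qed.

Lemma bfun_norm_ge0 (f : bfun) : 0 <= bfun_norm f.
Proof. by apply: sup_range_ge0 => //; exact: bfun_has_ubound. Qed.

Lemma bfun_normD f g : bfun_norm (f + g) <= bfun_norm f + bfun_norm g.
Proof.
apply: (@sup_range_le _ _ (fun t => `|(f + g) t|)) => [|t].
  by rewrite addr_ge0 ?bfun_norm_ge0.
by rewrite bfunDE (le_trans (ler_normD _ _))// lerD ?ler_bfun_norm.
Qed.

Lemma bfun_normZ (a : R) f : bfun_norm (a *: f) = `|a| * bfun_norm f.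
Proof.
rewrite /bfun_norm -sup_rangeZ//; last exact: bfun_has_ubound.
by under eq_fun do rewrite bfunZE normrM.
Qed.

Lemma bfun_norm_eq0 f : bfun_norm f = 0 -> f = 0.
Proof.
move=> f0; apply: bfunE => t; apply/eqP.
by rewrite bfun0E -normr_le0 -f0 ler_bfun_norm.
Qed.

HB.instance Definition _ := Lmodule_isNormed.Build R bfun
  bfun_normD bfun_normZ bfun_norm_eq0.

Lemma norm_bfun (f : bfun) : `|f| = sup (range (fun t => `|f t|)).
Proof. by []. Qed.

Lemma bfun_normM (f g : bfun) : `|f ** g| <= `|f| * `|g|.
Proof.
apply: (@sup_range_le _ _ (fun t => `|(f ** g) t|)) => [|t]; first by rewrite mulr_ge0.
by rewrite bfunME normrM ler_pM// ler_bfun_norm.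
Qed.

HB.instance Definition _ := NUAlgebra_isNormed.Build R bfun bfun_normM.

End BoundedFunctions.
Arguments bfun : clear implicits.

Section DirectSum.
Variables (R : realType) (I : Type) (X : I -> nuAlgType R).

Record dsum := DSum {
  dsum_fun :> forall i, X i;
  dsum_finite : finite_set [set i | dsum_fun i <> 0] }.

HB.instance Definition _ := gen_eqMixin dsum.
HB.instance Definition _ := gen_choiceMixin dsum.

Lemma dsumE (x y : dsum) : (forall i, x i = y i) -> x = y.
Proof.
case: x y => [x fx] [y fy] /= xy; have {}xy := functional_extensionality_dep xy.
by subst y; congr DSum; exact: Prop_irrelevance.
Qed.

Lemma dsum_zero_proof : finite_set [set i | (0 : X i) <> 0].
Proof. by rewrite (_ : [set _ | _] = set0)//; apply/seteqP; split => // i /=. Qed.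

Lemma dsum_opp_proof (x : dsum) : finite_set [set i | - x i <> 0].
Proof.
apply: sub_finite_set (dsum_finite x) => i /= nx x0.
by apply: nx; rewrite x0 oppr0.
Qed.

Lemma dsum_add_proof (x y : dsum) : finite_set [set i | x i + y i <> 0].
Proof.
have := conj (dsum_finite x) (dsum_finite y); rewrite -finite_setU.
apply: sub_finite_set => i /= xy; have [x0|] := pselect (x i = 0); last by left.
by right => y0; apply: xy; rewrite x0 y0 addr0.
Qed.

Lemma dsum_scale_proof (a : R) (x : dsum) : finite_set [set i | a *: x i <> 0].
Proof.
apply: sub_finite_set (dsum_finite x) => i /= nx x0.
by apply: nx; rewrite x0 scaler0.
Qed.

Lemma dsum_mul_proof (x y : dsum) : finite_set [set i | x i ** y i <> 0].
Proof.
apply: sub_finite_set (dsum_finite x) => i /= nx x0.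
by apply: nx; rewrite x0 -{1}(scale0r (0 : X i)) amulZl scale0r.
Qed.

Definition dsum_zero := DSum dsum_zero_proof.
Definition dsum_opp x := DSum (dsum_opp_proof x).
Definition dsum_add x y := DSum (dsum_add_proof x y).
Definition dsum_scale a x := DSum (dsum_scale_proof a x).
Definition dsum_mul x y := DSum (dsum_mul_proof x y).

Lemma dsum_addA : associative dsum_add.
Proof. by move=> x y z; apply: dsumE => i; rewrite /= addrA. Qed.
Lemma dsum_addC : commutative dsum_add.
Proof. by move=> x y; apply: dsumE => i; rewrite /= addrC. Qed.
Lemma dsum_add0 : left_id dsum_zero dsum_add.
Proof. by move=> x; apply: dsumE => i; rewrite /= add0r. Qed.
Lemma dsum_addN : left_inverse dsum_zero dsum_opp dsum_add.
Proof. by move=> x; apply: dsumE => i; rewrite /= addNr. Qed.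

HB.instance Definition _ := GRing.isZmodule.Build dsum
  dsum_addA dsum_addC dsum_add0 dsum_addN.

Lemma dsum_scaleA a b x : dsum_scale a (dsum_scale b x) = dsum_scale (a * b) x.
Proof. by apply: dsumE => i; rewrite /= scalerA. Qed.
Lemma dsum_scale1 : left_id 1 dsum_scale.
Proof. by move=> x; apply: dsumE => i; rewrite /= scale1r. Qed.
Lemma dsum_scaleDr : right_distributive dsum_scale +%R.
Proof. by move=> a x y; apply: dsumE => i; rewrite /= scalerDr. Qed.
Lemma dsum_scaleDl x : {morph dsum_scale^~ x : a b / a + b}.
Proof. by move=> a b; apply: dsumE => i; rewrite /= scalerDl. Qed.

HB.instance Definition _ := GRing.Zmodule_isLmodule.Build R dsum
  dsum_scaleA dsum_scale1 dsum_scaleDr dsum_scaleDl.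

Lemma dsum_mulA : associative dsum_mul.
Proof. by move=> x y z; apply: dsumE => i; rewrite /= amulA. Qed.
Lemma dsum_mulDl : left_distributive dsum_mul +%R.
Proof. by move=> x y z; apply: dsumE => i; rewrite /= amulDl. Qed.
Lemma dsum_mulDr : right_distributive dsum_mul +%R.
Proof. by move=> x y z; apply: dsumE => i; rewrite /= amulDr. Qed.
Lemma dsum_mulZl (a : R) x y : dsum_mul (a *: x) y = a *: dsum_mul x y.
Proof. by apply: dsumE => i; rewrite /= amulZl. Qed.
Lemma dsum_mulZr (a : R) x y : dsum_mul x (a *: y) = a *: dsum_mul x y.
Proof. by apply: dsumE => i; rewrite /= amulZr. Qed.

HB.instance Definition _ := Lmodule_isNUAlgebra.Build R dsum
  dsum_mulA dsum_mulDl dsum_mulDr dsum_mulZl dsum_mulZr.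

Lemma dsum0E i : (0 : dsum) i = 0. Proof. by []. Qed.
Lemma dsumDE (x y : dsum) i : (x + y) i = x i + y i. Proof. by []. Qed.
Lemma dsumZE (a : R) (x : dsum) i : (a *: x) i = a *: x i. Proof. by []. Qed.
Lemma dsumME (x y : dsum) i : (x ** y) i = x i ** y i. Proof. by []. Qed.

End DirectSum.

Section NormedDirectSum.
Variables (R : realType) (I : Type) (X : I -> normedNUAlgType R).

Definition normed_dsum := dsum X.

HB.instance Definition _ := NUAlgebra.on normed_dsum.

Definition dsum_norm (x : normed_dsum) : R := sup (range (fun i => `|x i|)).

Lemma dsum_has_ubound (x : normed_dsum) : has_ubound (range (fun i => `|x i|)).
Proof.
have := finite_image (fun i => `|x i|) (dsum_finite x).
move=> /finite_seqP[s xs]; exists (\sum_(r <- s) `|r|) => _ [i _ <-].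
have [->|xi] := pselect (x i = 0); first by rewrite normr0 sumr_ge0.
have /= si : [set` s] `|x i| by rewrite -xs; exists i.
by rewrite (big_rem _ si)/= normr_id lerDl sumr_ge0.
Qed.

Lemma ler_dsum_norm (x : normed_dsum) i : `|x i| <= dsum_norm x.
Proof. exact: (sup_range_ub i (dsum_has_ubound x)). Qed.

Lemma dsum_norm_ge0 (x : normed_dsum) : 0 <= dsum_norm x.
Proof. by apply: sup_range_ge0 => //; exact: dsum_has_ubound. Qed.

Lemma dsum_normD x y : dsum_norm (x + y) <= dsum_norm x + dsum_norm y.
Proof.
apply: (@sup_range_le _ _ (fun i => `|(x + y) i|)) => [|i].
  by rewrite addr_ge0 ?dsum_norm_ge0.
by rewrite dsumDE (le_trans (ler_normD _ _))// lerD ?ler_dsum_norm.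
Qed.

Lemma dsum_normZ (a : R) x : dsum_norm (a *: x) = `|a| * dsum_norm x.
Proof.
rewrite /dsum_norm -sup_rangeZ//; last exact: dsum_has_ubound.
by under eq_fun do rewrite dsumZE normrZ.
Qed.

Lemma dsum_norm_eq0 x : dsum_norm x = 0 -> x = 0.
Proof.
move=> x0; apply: dsumE => i; apply/eqP.
by rewrite dsum0E -normr_le0 -x0 ler_dsum_norm.
Qed.

HB.instance Definition _ := Lmodule_isNormed.Build R normed_dsum
  dsum_normD dsum_normZ dsum_norm_eq0.

Lemma norm_dsum (x : normed_dsum) : `|x| = sup (range (fun i => `|x i|)).
Proof. by []. Qed.

Lemma dsum_normM (x y : normed_dsum) : `|x ** y| <= `|x| * `|y|.
Proof.
apply: (@sup_range_le _ _ (fun i => `|(x ** y) i|)) => [|i]; first by rewrite mulr_ge0.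
rewrite dsumME (le_trans (ler_norm_amul _ _))//.
by rewrite ler_pM// ler_dsum_norm.
Qed.

HB.instance Definition _ := NUAlgebra_isNormed.Build R normed_dsum dsum_normM.

End NormedDirectSum.

Section ContinuousFunctionAlgebras.
Variables (R : realType) (T : topologicalType).

Definition C00_set : set (bfun R T) :=
  [set f | continuous (f : T -> R) /\ compact (closure [set t | f t <> 0])].

Definition C0_set : set (bfun R T) :=
  [set f | continuous (f : T -> R) /\
    forall n : nat, compact [set t | n.+1%:R^-1 <= `|f t|] ].

Lemma bfun_lin_continuous (a : R) (f g : bfun R T) :
  continuous (f : T -> R) -> continuous (g : T -> R) ->
  continuous ((a *: f + g : bfun R T) : T -> R).
Proof.
by move=> cf cg t; apply: cvgD; [apply: cvgZr; exact: cf|exact: cg].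
Qed.

Lemma bfun_mul_continuous (f g : bfun R T) :
  continuous (f : T -> R) -> continuous (g : T -> R) ->
  continuous ((f ** g : bfun R T) : T -> R).
Proof. by move=> cf cg t; apply: cvgM; [exact: cf|exact: cg]. Qed.

Lemma C00_is_subalgebra : is_subalgebra C00_set.
Proof.
split.
- split; first exact: cst_continuous.
  rewrite (_ : [set t | _] = set0) ?closure0; first exact: compact0.
  by apply/seteqP; split => // t /=.
- move=> a f g [cf kf] [cg kg]; split; first exact: bfun_lin_continuous.
  apply: (subclosed_compact (@closed_closure _ _) (compactU kf kg)).
  rewrite -closureU; apply: closureS => t; rewrite /mkset bfunDE bfunZE => fg.
  have [f0|] := pselect (f t = 0); last by left.
  by right => g0; apply: fg; rewrite f0 g0 mulr0 addr0.
- move=> f g [cf kf] [cg kg]; split; first exact: bfun_mul_continuous.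
  apply: (subclosed_compact (@closed_closure _ _) kf).
  apply: closureS => t; rewrite /mkset bfunME => fg f0.
  by apply: fg; rewrite f0 mul0r.
Qed.

Definition C00 : subalgebra (bfun R T) := Subalgebra C00_is_subalgebra.

Lemma closed_norm_ge (f : T -> R) (e : R) : continuous f ->
  closed [set t | e <= `|f t|].
Proof.
move=> cf; apply: (@preimage_closed _ _ (fun t => `|f t|) [set x | e <= x]).
  by move=> t _; apply: continuous_comp; [exact: cf|exact: norm_continuous].
exact: closed_ge.
Qed.

Lemma C0_compact (f : bfun R T) (e : R) : C0_set f -> 0 < e ->
  compact [set t | e <= `|f t|].
Proof.
move=> [cf kf] e0; have [n ne] : exists n : nat, n.+1%:R^-1 <= e.
  have [n] : exists n : nat, e^-1 < n.+1%:R.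
    by exists (Num.truncn e^-1); rewrite truncnS_gt.
  by move=> en; exists n; rewrite invf_ple ?posrE// ltW.
apply: (subclosed_compact (closed_norm_ge (e := e) cf) (kf n)) => t /=.
exact: le_trans.
Qed.

Lemma C0_is_subalgebra : is_subalgebra C0_set.
Proof.
split.
- split; first exact: cst_continuous.
  move=> n; rewrite (_ : [set t | _] = set0); first exact: compact0.
  by apply/seteqP; split => // t /=; rewrite normr0 leNgt invr_gt0 ltr0Sn.
- move=> a f g Cf Cg; have cfg := bfun_lin_continuous (a := a) Cf.1 Cg.1.
  split=> // n; set e := n.+1%:R^-1.
  have e0 : 0 < e / 2 by rewrite divr_gt0// invr_gt0.
  have a0 : 0 < `|a| + 1 by rewrite ltr_wpDl.
  have kf := C0_compact Cf (divr_gt0 e0 a0); have kg := C0_compact Cg e0.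
  apply: (subclosed_compact (closed_norm_ge cfg) (compactU kf kg)) => t; rewrite /mkset => efg.
  have [|fe] := leP (e / 2 / (`|a| + 1)) `|f t|; first by left.
  right => /=; rewrite leNgt; apply/negP => ge.
  move: efg; apply/negP; rewrite -ltNge bfunDE bfunZE.
  rewrite (le_lt_trans (ler_normD _ _))// [e]splitr ler_ltD// normrM.
  rewrite (le_trans (ler_wpM2l (normr_ge0 a) (ltW fe)))//.
  by rewrite mulrCA ler_piMr ?(ltW e0)// ler_pdivrMr// mul1r lerDl.
- move=> f g Cf Cg; have cfg := bfun_mul_continuous Cf.1 Cg.1.
  split=> // n; set e := n.+1%:R^-1; have [M gM] := bfun_bounded g.
  have e0 : 0 < e by rewrite invr_gt0.
  have M0 : 0 < `|M| + 1 by rewrite ltr_wpDl.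
  have kf := C0_compact Cf (divr_gt0 e0 M0).
  apply: (subclosed_compact (closed_norm_ge cfg) kf) => t.
  rewrite /mkset bfunME normrM ler_pdivrMr// => /le_trans; apply.
  by rewrite ler_wpM2l// (le_trans (gM t))// (le_trans (ler_norm M))// lerDl.
Qed.

Definition C0 : subalgebra (bfun R T) := Subalgebra C0_is_subalgebra.

End ContinuousFunctionAlgebras.

Section UpperDensity.
Variable R : realType.
Implicit Types A B : set nat.

(* The positive integer k.+1 is represented by k : nat, so the term of index n *)
(* below is |A /\ {1, ..., n.+1}| / n.+1 .                                     *)
Definition density_seq A (n : nat) : R :=
  #|[pred k : 'I_n.+1 | `[< A k >] ]|%:R / n.+1%:R.

Definition upper_density A : R := limn_sup (density_seq A).

Lemma density_seq_ge0 A n : 0 <= density_seq A n.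
Proof. by rewrite divr_ge0. Qed.

Lemma density_seq_le1 A n : density_seq A n <= 1.
Proof.
by rewrite /density_seq ler_pdivrMr ?ltr0Sn// mul1r ler_nat (leq_trans (max_card _))// card_ord.
Qed.

Lemma density_seqS A B n : A `<=` B -> density_seq A n <= density_seq B n.
Proof.
move=> AB; rewrite /density_seq ler_wpM2r ?invr_ge0// ler_nat subset_leq_card//.
by apply/fintype.subsetP => k; rewrite !inE; exact: AB.
Qed.

Lemma density_seqU A B n :
  density_seq (A `|` B) n <= density_seq A n + density_seq B n.
Proof.
rewrite /density_seq -mulrDl ler_wpM2r ?invr_ge0// -natrD ler_nat -cardUI.
apply: leq_trans (leq_addr _ _); apply: subset_leq_card.
apply/fintype.subsetP => k /asboolP[Ak|Bk]; apply/orP; [left|right].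
  exact: asboolT Ak.
exact: asboolT Bk.
Qed.

Lemma upper_density0P A : upper_density A = 0 <-> density_seq A @ \oo --> 0.
Proof.
split=> [A0|/cvg_limn_inf_sup[]//].
have ub : has_ubound (range (density_seq A)).
  by exists 1 => _ [n _ <-]; exact: density_seq_le1.
have lb : has_lbound (range (density_seq A)).
  by exists 0 => _ [n _ <-]; exact: density_seq_ge0.
have cs : sups (density_seq A) @ \oo --> (0 : R).
  by rewrite -A0; apply: cvgP (cvg_sups_inf ub lb).
apply: (squeeze_cvgr _ (cvg_cst 0) cs); near=> n.
rewrite density_seq_ge0/=; apply: ub_le_sup; last by exists n => //=.
exact: has_ubound_sdrop.
Unshelve. all: by end_near. Qed.

Lemma upper_density0_subset A B : A `<=` B ->
  upper_density B = 0 -> upper_density A = 0.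
Proof.
move=> AB /upper_density0P B0; apply/upper_density0P.
apply: (squeeze_cvgr _ (cvg_cst 0) B0); near=> n.
by rewrite density_seq_ge0 density_seqS.
Unshelve. all: by end_near. Qed.

Lemma upper_density0U A B : upper_density A = 0 -> upper_density B = 0 ->
  upper_density (A `|` B) = 0.
Proof.
move=> /upper_density0P A0 /upper_density0P B0; apply/upper_density0P.
have AB0 : (fun n => density_seq A n + density_seq B n) @ \oo --> (0 : R).
  by rewrite -[X in _ --> X]addr0; exact: cvgD.
apply: (squeeze_cvgr _ (cvg_cst 0) AB0); near=> n.
by rewrite density_seq_ge0 density_seqU.
Unshelve. all: by end_near. Qed.

Lemma upper_density_set0 : upper_density set0 = 0.
Proof.
apply/upper_density0P; rewrite (_ : density_seq set0 = cst 0); last first.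
  apply/funext => n; rewrite /density_seq eq_card0 ?mul0r// => k.
  by apply/asboolP.
exact: cvg_cst.
Qed.

End UpperDensity.

Section SequenceAlgebras.
Variable R : realType.

Definition linf := bfun R nat.
HB.instance Definition _ := NormedNUAlgebra.on linf.

Definition c00_set : set linf := [set x | finite_set [set k | x k <> 0]].

Definition c0_set : set linf := [set x | (x : nat -> R) @ \oo --> 0].

Definition d00_set : set linf :=
  [set x | upper_density R [set k | x k <> 0] = 0].

Definition d0_set : set linf :=
  [set x | forall e : R, 0 < e -> upper_density R [set k | e <= `|x k|] = 0].

Lemma c00_is_ideal : is_ideal c00_set.
Proof.
split.
- by apply: sub_finite_set (finite_set0 nat) => k /=.
- move=> a x y fx fy; apply: sub_finite_set (_ : finite_set
    ([set k | x k <> 0] `|` [set k | y k <> 0])); last by rewrite finite_setU.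
  move=> k; rewrite /mkset bfunDE bfunZE => xy.
  have [x0|] := pselect (x k = 0); last by left.
  by right => y0; apply: xy; rewrite x0 y0 mulr0 addr0.
- move=> x y fy; split; apply: sub_finite_set fy => k;
    rewrite /mkset bfunME => xy y0; apply: xy.
    by rewrite y0 mulr0.
  by rewrite y0 mul0r.
Qed.

Definition c00 : ideal linf := Ideal c00_is_ideal.

Lemma cvg_bounded_mul0 (x y : linf) :
  (y : nat -> R) @ \oo --> 0 -> (fun k => x k * y k) @ \oo --> (0 : R).
Proof.
move=> y0; have [M xM] := bfun_bounded x.
apply/norm_cvg0P; have My : (fun k => M * `|y k|) @ \oo --> (0 : R).
  by rewrite -(mulr0 M); apply: cvgM; [exact: cvg_cst|exact/norm_cvg0P].
apply: (squeeze_cvgr _ (cvg_cst 0) My); near=> k.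
by rewrite normr_ge0 normrM ler_wpM2r.
Unshelve. all: by end_near. Qed.

Lemma c0_is_ideal : is_ideal c0_set.
Proof.
split.
- exact: cvg_cst.
- move=> a x y x0 y0; rewrite /c0_set /mkset -[X in _ --> X](addr0 (0 : R)).
  apply: cvgD => //; rewrite -[X in _ --> X](mulr0 a).
  by apply: cvgM => //; exact: cvg_cst.
- move=> x y y0; split; first exact: cvg_bounded_mul0.
  have := cvg_bounded_mul0 x y0.
  by rewrite /c0_set /mkset; under eq_fun do rewrite mulrC.
Qed.

Lemma c0_closed : closed c0_set.
Proof.
move=> x clx; rewrite /c0_set /mkset; apply/cvgrPdist_lt => e e0.
have e20 : 0 < e / 2 by rewrite divr_gt0.
have [y [y0]] := clx _ (nbhsx_ballx x _ e20).
rewrite -ball_normE /= => xy; move/cvgrPdist_lt : y0 => /(_ _ e20).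
apply: filterS => k; rewrite !sub0r !normrN => yk.
rewrite -[x k](subrK (y k)) (le_lt_trans (ler_normD _ _))//.
rewrite [e]splitr ltr_leD// ?(ltW yk)//.
exact: le_lt_trans (ler_bfun_norm (x - y) k) xy.
Qed.

Definition c0 : closed_ideal linf :=
  @ClosedIdeal R linf (Ideal c0_is_ideal) c0_closed.

Lemma d00_is_ideal : is_ideal d00_set.
Proof.
split.
- by apply: upper_density0_subset (upper_density_set0 R) => k /=.
- move=> a x y x0 y0; apply: upper_density0_subset (upper_density0U x0 y0).
  move=> k; rewrite /mkset bfunDE bfunZE => xy.
  have [xk|] := pselect (x k = 0); last by left.
  by right => yk; apply: xy; rewrite xk yk mulr0 addr0.
- move=> x y y0; split; apply: upper_density0_subset y0 => k;
    rewrite /mkset bfunME => xy yk; apply: xy.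
    by rewrite yk mulr0.
  by rewrite yk mul0r.
Qed.

Lemma d0_is_ideal : is_ideal d0_set.
Proof.
have d0M (x y : linf) : d0_set y -> d0_set (x ** y).
  move=> y0 e e0; have [M xM] := bfun_bounded x.
  have M0 : 0 < `|M| + 1 by rewrite ltr_wpDl.
  apply: upper_density0_subset (y0 _ (divr_gt0 e0 M0)) => k.
  rewrite /mkset bfunME normrM ler_pdivrMr// mulrC => /le_trans; apply.
  by rewrite ler_wpM2l// (le_trans (xM k))// (le_trans (ler_norm M))// lerDl.
split.
- move=> e e0; apply: upper_density0_subset (upper_density_set0 R) => k /=.
  by rewrite normr0 leNgt e0.
- move=> a x y x0 y0 e e0; have e20 : 0 < e / 2 by rewrite divr_gt0.
  have a0 : 0 < `|a| + 1 by rewrite ltr_wpDl.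
  apply: upper_density0_subset
    (upper_density0U (x0 _ (divr_gt0 e20 a0)) (y0 _ e20)) => k.
  rewrite /mkset bfunDE bfunZE => exy.
  have [|xe] := leP (e / 2 / (`|a| + 1)) `|x k|; first by left.
  right => /=; rewrite leNgt; apply/negP => ye.
  move: exy; apply/negP; rewrite -ltNge.
  rewrite (le_lt_trans (ler_normD _ _))// [e]splitr ler_ltD// normrM.
  rewrite (le_trans (ler_wpM2l (normr_ge0 a) (ltW xe)))//.
  by rewrite mulrCA ler_piMr ?(ltW e20)// ler_pdivrMr// mul1r lerDl.
- move=> x y y0; split; first exact: d0M.
  rewrite (_ : y ** x = x ** y); first exact: d0M.
  by apply: bfunE => k; rewrite !bfunME mulrC.
Qed.

Definition d00 : subalgebra linf := ideal_subalgebra (Ideal d00_is_ideal).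

Definition d0 : subalgebra linf := ideal_subalgebra (Ideal d0_is_ideal).

End SequenceAlgebras.
Arguments c00_set : clear implicits.
Arguments c0_set : clear implicits.
Arguments d00_set : clear implicits.
Arguments d0_set : clear implicits.

Definition is_stone_cech (R : realType) (T K : topologicalType) (i : T -> K) :=
  [/\ compact [set: K], hausdorff_space K, dense (range i),
      injective i /\ (forall U : set T,
        open U <-> exists2 V : set K, open V & U = i @^-1` V) &
      forall f : T -> R, continuous f -> bounded_fun f ->
        exists2 F : K -> R, continuous F & F \o i = f].

Section StoneCech.
Variable R : realType.

Definition RlinfT : topologicalType :=
  prod_topology (fun _ : linf R => R : topologicalType).

(* Evaluation embedding of nat into the product of copies of R indexed by all  *)
(* bounded real functions on nat; the closure of its range is the Stone-Cech   *)
(* compactification of the discrete space nat (see betaN_is_stone_cech).       *)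
Definition evalN (n : nat) : RlinfT :=
  fun x => x n.

Definition betaN : topologicalType := set_type (closure (range evalN)).

Lemma evalN_betaN n : evalN n \in closure (range evalN).
Proof. by apply/mem_set/subset_closure; exists n. Qed.

Definition betaN_of (n : nat) : betaN :=
  exist (fun p => p \in closure (range evalN)) (evalN n) (evalN_betaN n).

Definition betaN_val : betaN -> RlinfT := @proj1_sig _ _.

Lemma betaN_valP (p : betaN) : closure (range evalN) (betaN_val p).
Proof. by case: p => p /= /set_mem. Qed.

Lemma betaN_val_continuous : continuous betaN_val.
Proof. exact: (@initial_continuous _ _ (@set_val _ (closure (range evalN)))). Qed.

Lemma betaN_coord_continuous (x : linf R) :
  continuous (fun p : betaN => (betaN_val p x : R)).
Proof.
move=> p; apply: (@continuous_comp _ _ _ betaN_val (fun q : RlinfT => q x : R)).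
  exact: betaN_val_continuous.
exact: (@proj_continuous _ (fun=> R : topologicalType) x).
Qed.

Lemma compact_betaN : compact [set: betaN].
Proof.
have kK : compact (closure (range evalN)).
  pose B (x : linf R) : set R := `[- `|x|, `|x|]%classic.
  have kB : compact [set p : RlinfT | forall x, B x (p x)].
    exact: (@tychonoff (linf R) (fun=> R : topologicalType) B
      (fun x => @segment_compact R (- `|x|) `|x|)).
  apply: (subclosed_compact (@closed_closure _ _) kB) => p clp x.
  have : closed [set q : RlinfT | B x (q x)].
    apply: (@preimage_closed _ _ (fun q : RlinfT => q x : R) (B x)).
      by move=> q _; exact: (@proj_continuous _ (fun=> R : topologicalType) x q).
    exact: itv_closed.
  apply; move: clp; apply: closureS => _ [n _ <-]; rewrite /B /= in_itv/= -ler_norml.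
  exact: ler_bfun_norm.
move=> F FF _.
have [|p [Kp clp]] := kK (betaN_val @ F) _.
  rewrite /= /fmap /mkset.
  by apply: (@filterS _ F _ _ _ _ filterT) => q _; exact: betaN_valP.
exists (exist (fun p => p \in closure (range evalN)) p (mem_set Kp)); split => //.
move=> A U FA [_ [[W oW <-]] /= Wp WU].
have [||_ [[q Aq <-] Wq]] := clp (betaN_val @` A) W.
- by apply: (@filterS _ F _ A) FA => q Aq; exists q.
- exact: (@open_nbhs_nbhs RlinfT).
- by exists q; split => //; exact: WU.
Qed.

Lemma betaN_is_stone_cech : is_stone_cech R betaN_of.
Proof.
split.
- exact: compact_betaN.
- move=> p q clpq; apply: val_inj; apply/funext => x.
  apply: (@Rhausdorff R) => U V nU nV.
  have [r [Ur Vr]] := clpq _ _ (betaN_coord_continuous nU) (betaN_coord_continuous nV).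
  by exists (betaN_val r x).
- move=> O [p Op] [W oW WO]; move: Op; rewrite -WO => Wp.
  have [_ [[n _ <-] Wn]] := betaN_valP (open_nbhs_nbhs (conj oW Wp)).
  by exists (betaN_of n); split => //; exists n.
- have indP (A : set nat) : exists M : R, forall n, `|(`[< A n >])%:R| <= M.
    by exists 1 => n; case: `[< A n >]; rewrite /= ?normr1 ?normr0.
  pose ind (A : set nat) : linf R := mk_bfun (indP A).
  split=> [m n mn|U].
    have : betaN_val (betaN_of m) (ind [set n]) = betaN_val (betaN_of n) (ind [set n]).
      by rewrite mn.
    have [//|mn'] := pselect (m = n).
    by rewrite /= asboolF// asboolT// => /eqP; rewrite eq_sym oner_eq0.
  split=> [_|_]; last exact: discrete_open.
  exists ((fun p : betaN => betaN_val p (ind U)) @^-1` [set y | 2^-1 < y]).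
    by apply: open_comp; [move=> p _; exact: betaN_coord_continuous|exact: open_gt].
  apply/seteqP; split => n /=.
    by move=> Un; rewrite asboolT// invf_lt1 ?ltr1n.
  have [//|Un] := pselect (U n).
  by rewrite asboolF// ltNge invr_ge0 ler0n.
- move=> f _ /bounded_funP bf; exists (fun p => betaN_val p (mk_bfun bf)).
    exact: betaN_coord_continuous.
  by apply/funext.
Qed.

Definition density0_union : set betaN :=
  \bigcup_(A in [set A : set nat | upper_density R A = 0]) closure (betaN_of @` A).

End StoneCech.
Arguments density0_union : clear implicits.

(* Main.v *)
Require Import Defs.
From HB Require Import structures.
From mathcomp Require Import all_boot all_order all_algebra.
From mathcomp Require Import all_classical all_reals.
From mathcomp Require Import topology normedtype sequences.
From mathcomp Require Import zify lra.

Import Order.TTheory GRing.Theory Num.Theory.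
Import numFieldNormedType.Exports.

Local Open Scope classical_set_scope.
Local Open Scope ring_scope.

Set Implicit Arguments.
Unset Strict Implicit.
Unset Printing Implicit Defensive.

(** Membership of a bounded sequence in d00 or d0 depends only on its support,
or on its level sets, through the ideal of sets of upper density zero.

The isomorphisms with C00(Y) and C0(Y) come from extending a bounded sequence
x to a continuous function on beta N and restricting that function to Y
([to_Y]).  Since Y contains N, which is dense, this is an isometric morphism,
inverted on continuous functions by restriction to N.  It matches d00 with
C00(Y) and d0 with C0(Y) because the closures cl A, for A of density zero, are
a cofinal family of compact subsets of Y: each cl A is clopen in beta N, they
are directed under inclusion and they cover Y, so a compact subset of Y lies
in one of them ([compact_sub_closureY]); and a set of integers whose closure
lies in cl A is contained in A.

The copies of direct sums are all obtained by gluing ([glue_morphism],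
[glue_isometry]).  Given injections e i : N -> N whose ranges together have
density zero, a family u of finite support is sent to the class of a sequence
y, supported on finitely many of these ranges, whose pull-back along e i
represents u i for every i.  The ranges only have to be disjoint up to an
error that the quotient does not see.  For the first copy they are disjoint
and no quotient is taken.  For the other two they are indexed by the branches
of the binary tree: a branch gives the set of (codes of) its finite initial
segments, two distinct branches share only finitely many of them, and there
are continuum many branches.  Codes are squared, which makes the union of all
the ranges a set of density zero.

Neither algebra is unital because a unit would be the constant sequence 1, as
one sees by multiplying it with the indicator of a singleton. *)

(** * Algebra morphisms and copies of algebras *)

Section Morphisms.
Context {R : realType}.

Lemma algebra_morphism0 (A B : nuAlgType R) (f : A -> B) :
  algebra_morphism f -> f 0 = 0.
Proof. by move=> [fL _]; have := fL (-1) 0 0; rewrite scaler0 addr0 scaleN1r addNr. Qed.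

Lemma algebra_morphismB (A B : nuAlgType R) (f : A -> B) x y :
  algebra_morphism f -> f (x - y) = f x - f y.
Proof. by move=> [fL _]; rewrite addrC -scaleN1r fL scaleN1r addrC. Qed.

Lemma range_is_subalgebra (A B : nuAlgType R) (F : B -> A) :
  algebra_morphism F -> is_subalgebra (range F).
Proof.
move=> Fm; have [FL FM] := Fm; split; first by exists 0 => //; exact: algebra_morphism0.
  by move=> a _ _ [x _ <-] [y _ <-]; exists (a *: x + y); rewrite ?FL.
by move=> _ _ [x _ <-] [y _ <-]; exists (x ** y); rewrite ?FM.
Qed.

(** The inverse on the range is returned together with its defining equation, from
which the isometric case can be read off. *)
Lemma injective_range_isomorphic (A B : nuAlgType R) (F : B -> A) :
  algebra_morphism F -> injective F ->
  exists (S : subalgebra A) (G : subalg S -> B),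
    [/\ algebra_morphism G, bijective G & forall s, F (G s) = val s].
Proof.
move=> Fm Fi; have [FL FM] := Fm; exists (Subalgebra (range_is_subalgebra Fm)).
set S := Subalgebra _.
have ex (s : subalg S) : exists b, F b = val s.
  by case: (set_mem (valP s)) => b _ bs; exists b.
pose G s := projT1 (cid (ex s)).
have FG s : F (G s) = val s by rewrite /G; case: cid.
have inS b : F b \in (S : set A) by apply/mem_set; exists b.
exists G; split => //.
  split=> [a s t|s t]; apply: Fi.
    by rewrite FL !FG val_subalgD val_subalgZ.
  by rewrite FM !FG val_subalgM.
exists (fun b => exist (fun z => z \in (S : set A)) (F b) (inS b)) => [s|b].
  by apply: val_inj; rewrite /= FG.
by apply: Fi; rewrite FG.
Qed.

Lemma injective_contains_copy (A B : nuAlgType R) (F : B -> A) :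
  algebra_morphism F -> injective F -> contains_copy A B.
Proof.
move=> Fm Fi; have [S [G [Gm Gb _]]] := injective_range_isomorphic Fm Fi.
by exists S, G.
Qed.

Lemma isometric_contains_normed_copy (A B : normedNUAlgType R) (F : B -> A) :
  algebra_morphism F -> (forall x, `|F x| = `|x|) -> contains_normed_copy A B.
Proof.
move=> Fm FN.
have Fi : injective F.
  move=> x y xy; apply/eqP; rewrite -subr_eq0 -normr_eq0 -FN.
  by rewrite (algebra_morphismB _ _ Fm) xy subrr normr0.
have [S [G [Gm Gb FG]]] := injective_range_isomorphic Fm Fi.
by exists S, G; split=> // s; rewrite -FN FG.
Qed.

End Morphisms.

(** * Gluing sequences along a family of injections *)

Section Gluing.
Context {R : realType}.

Lemma pullback_proof (g : nat -> nat) (x : linf R) :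
  exists M, forall n, `|x (g n)| <= M.
Proof. by have [M xM] := bfun_bounded x; exists M => n. Qed.

Definition pullback (g : nat -> nat) (x : linf R) : linf R :=
  mk_bfun (pullback_proof g x).

Lemma pullback_morphism g : algebra_morphism (pullback g).
Proof. by split=> [a x y|x y]; apply: bfunE => n. Qed.

Lemma ler_norm_bfunP T (x : bfun R T) (M : R) : 0 <= M ->
  `|x| <= M <-> forall t, `|x t| <= M.
Proof.
move=> M0; split=> [xM t|]; first exact: le_trans (ler_bfun_norm x t) xM.
exact: (@sup_range_le _ _ (fun t => `|x t|)).
Qed.

Lemma ler_norm_pullback g (x : linf R) : `|pullback g x| <= `|x|.
Proof. by apply/ler_norm_bfunP => // n; exact: (ler_bfun_norm x (g n)). Qed.

Variables (I : Type) (e : I -> nat -> nat).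

Definition blocks (J : set I) : set nat := \bigcup_(i in J) range (e i).

Hypothesis e_inj : forall i, injective (e i).

(** No sum is formed: at a point of several blocks one of the candidate values is
taken.  This keeps the bound M, which a sum would not, and the value is the
expected one off the overlaps. *)
Lemma glue (J : set I) (x : I -> linf R) (M : R) : 0 <= M ->
  (forall i, J i -> `|x i| <= M) ->
  exists y : linf R, [/\ `|y| <= M, forall k, y k <> 0 -> blocks J k &
    forall i n, J i -> ~ blocks (J `\ i) (e i n) -> y (e i n) = x i n].
Proof.
move=> M0 xM.
pose P k (p : I * nat) := J p.1 /\ e p.1 p.2 = k.
pose f k := if pselect (exists p, P k p) is left h
  then x (projT1 (cid h)).1 (projT1 (cid h)).2 else 0.
have fM k : `|f k| <= M.
  rewrite /f; case: pselect => [h|_]; last by rewrite normr0.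
  by case: cid => -[i n] [/= Ji _]; rewrite (le_trans (ler_bfun_norm _ _))// xM.
have fb : exists M, forall k, `|f k| <= M by exists M.
exists (mk_bfun fb); split.
- by apply/ler_norm_bfunP.
- move=> k /=; rewrite /f; case: pselect => // h _.
  by have [[i n] [/= Ji <-]] := h; exists i => //; exists n.
move=> i n Ji nJ /=; rewrite /f; case: pselect => [h|[]]; last by exists (i, n).
case: cid => -[j m] [/= Jj ejm]; have [ji|ji] := pselect (j = i); last first.
  by case: nJ; exists j => //; exists m.
by subst j; rewrite (e_inj ejm).
Qed.

(** In this abstract situation pi : linf -> Q and rho : D -> P play the part of
quotient maps by the same ideal.  The hypotheses say that this ideal
contains the sequences supported on the overlap of a block with finitely many
others, that it is stable under pull-back along the injections, and that
membership can be tested block by block for a sequence that lives on finitely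
many blocks. *)
Variables (D : subalgebra (linf R)).
Hypothesis D_blocks : forall J (y : linf R), finite_set J ->
  (forall k, y k <> 0 -> blocks J k) -> (D : set (linf R)) y.

Section Algebraic.
Variables (Q P : nuAlgType R) (pi : linf R -> Q) (rho : subalg D -> P).
Hypotheses (pi_morphism : algebra_morphism pi)
  (rho_morphism : algebra_morphism rho).
Hypothesis pi_overlap : forall J i (z : linf R), finite_set J -> ~ J i ->
  (forall n, z n <> 0 -> blocks J (e i n)) -> pi z = 0.
Hypothesis pi_pullback : forall y, rho y = 0 ->
  forall i, pi (pullback (e i) (val y)) = 0.
Hypothesis rho_local : forall J (y : subalg D), finite_set J ->
  (forall k, val y k <> 0 -> blocks J k) ->
  (forall i, pi (pullback (e i) (val y)) = 0) -> rho y = 0.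

(** The image of u is characterized rather than computed: linearity,
multiplicativity and injectivity of the embedding then follow from the
corresponding properties of pull-back. *)
Definition represents (y : subalg D) (u : dsum (fun _ : I => Q)) :=
  (forall i, pi (pullback (e i) (val y)) = u i) /\
  exists2 J, finite_set J & forall k, val y k <> 0 -> blocks J k.

Lemma representsL (a : R) y z u v : represents y u -> represents z v ->
  represents (a *: y + z) (a *: u + v).
Proof.
move=> [yu [J fJ yJ]] [zv [K fK zK]]; split.
  move=> i; rewrite val_subalgD val_subalgZ (pullback_morphism _).1.
  by rewrite pi_morphism.1 yu zv.
exists (J `|` K); first by rewrite finite_setU.
move=> k; rewrite val_subalgD val_subalgZ bfunDE bfunZE => yz.
have [y0|/yJ[j Jj ej]] := pselect (val y k = 0); last by exists j => //; left.
have [|j Kj ej] := zK k; last by exists j => //; right.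
by move=> z0; apply: yz; rewrite y0 z0 mulr0 addr0.
Qed.

Lemma representsM y z u v : represents y u -> represents z v ->
  represents (y ** z) (u ** v).
Proof.
move=> [yu [J fJ yJ]] [zv _]; split.
  move=> i; rewrite val_subalgM (pullback_morphism _).2.
  by rewrite pi_morphism.2 yu zv.
exists J => // k; rewrite val_subalgM bfunME => yz; apply: yJ => y0.
by apply: yz; rewrite y0 mul0r.
Qed.

Lemma represents_unique y z u : represents y u -> represents z u ->
  rho y = rho z.
Proof.
move=> yu zu; have [d0 [J fJ dJ]] := representsL (-1) zu yu.
apply/eqP; rewrite -subr_eq0 -(algebra_morphismB _ _ rho_morphism).
apply/eqP; rewrite addrC -scaleN1r; apply: (rho_local fJ dJ) => i.
by rewrite d0 scaleN1r addNr.
Qed.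

(** Gluing preimages x i of the components of u that are bounded by M produces a
representative bounded by M; this control of the norm is what makes the
embedding isometric. *)
Lemma represents_exists (x : I -> linf R) (M : R) (u : dsum (fun _ : I => Q)) :
  0 <= M -> (forall i, u i <> 0 -> `|x i| <= M /\ pi (x i) = u i) ->
  exists y, represents y u /\ `|val y| <= M.
Proof.
move=> M0 xu; pose J := [set i | u i <> 0]; have fJ : finite_set J := dsum_finite u.
have [|y [yM yJ yx]] := @glue J x M M0; first by move=> i /xu[].
have Dy : y \in (D : set (linf R)) by apply/mem_set; exact: D_blocks yJ.
exists (exist (fun z => z \in (D : set (linf R))) y Dy); split=> //.
split; last by exists J.
move=> i; have [ui|ui] := pselect (u i = 0).
  (* i is not in J, so the block of i meets the support of y in overlaps only *)
  by rewrite ui; apply: (pi_overlap (J := J) (i := i)) => // n; exact: yJ.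
have [_ <-] := xu i ui; apply/eqP; rewrite -subr_eq0.
rewrite -(algebra_morphismB _ _ pi_morphism); apply/eqP.
apply: (pi_overlap (J := J `\ i) (i := i)); [exact: finite_setD|by move=> [_] /=|].
move=> n; apply: contra_notP => nJ.
rewrite -[LHS]/(y (e i n) - x i n); apply/eqP.
by rewrite subr_eq0; apply/eqP; exact: yx.
Qed.

Hypothesis pi_surj : forall q, exists x, pi x = q.

Lemma finite_bound (J : set I) (h : I -> R) : finite_set J ->
  exists2 M, 0 <= M & forall i, J i -> h i <= M.
Proof.
move=> fJ; have /finite_seqP[s hs] := finite_image h fJ.
exists (\sum_(r <- s) `|r|) => [|i Ji]; first by rewrite sumr_ge0.
have /= si : [set` s] (h i) by rewrite -hs; exists i.
by rewrite (big_rem _ si)/= (le_trans (ler_norm _))// lerDl sumr_ge0.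
Qed.

Lemma represents_total u : exists y, represents y u.
Proof.
have [x xu] := choice (fun i => pi_surj (u i)).
have [M M0 xM] := finite_bound (fun i => `|x i|) (dsum_finite u).
have [|y [yu _]] := @represents_exists x M u M0; last by exists y.
by move=> i ui; split; [exact: xM|exact: xu].
Qed.

Lemma glue_morphism : exists F : dsum (fun _ : I => Q) -> P,
  [/\ algebra_morphism F, injective F &
      forall y u, represents y u -> F u = rho y].
Proof.
pose r u := projT1 (cid (represents_total u)).
have rP u : represents (r u) u by rewrite /r; case: cid.
have FE y u : represents y u -> rho (r u) = rho y by exact: represents_unique.
exists (rho \o r); split=> //.
  split=> [a u v|u v] /=.
    by rewrite -rho_morphism.1; apply: FE; exact: representsL.
  by rewrite -rho_morphism.2; apply: FE; exact: representsM.
move=> u v /= uv; apply: dsumE => i.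
have := @pi_pullback (r u - r v); rewrite (algebra_morphismB _ _ rho_morphism).
rewrite uv subrr => /(_ erefl i); rewrite [r u - r v]addrC -scaleN1r.
rewrite (representsL (-1) (rP v) (rP u)).1 dsumDE dsumZE scaleN1r addrC.
by move/eqP; rewrite subr_eq0 => /eqP.
Qed.

End Algebraic.

Section Isometric.
Variables (Q P : normedNUAlgType R) (pi : linf R -> Q) (rho : subalg D -> P).
Hypotheses (pi_morphism : algebra_morphism pi)
  (rho_morphism : algebra_morphism rho).
Hypothesis pi_overlap : forall J i (z : linf R), finite_set J -> ~ J i ->
  (forall n, z n <> 0 -> blocks J (e i n)) -> pi z = 0.
Hypothesis pi_pullback : forall y, rho y = 0 ->
  forall i, pi (pullback (e i) (val y)) = 0.
Hypothesis rho_local : forall J (y : subalg D), finite_set J ->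
  (forall k, val y k <> 0 -> blocks J k) ->
  (forall i, pi (pullback (e i) (val y)) = 0) -> rho y = 0.
Hypothesis pi_le : forall x, `|pi x| <= `|x|.
Hypothesis rho_le : forall y, `|rho y| <= `|y|.
Hypothesis pi_lift : forall q eps, 0 < eps ->
  exists x, pi x = q /\ `|x| < `|q| + eps.
Hypothesis rho_lift : forall p eps, 0 < eps ->
  exists y, rho y = p /\ `|y| < `|p| + eps.

(** The norm of F u is at most that of u, since the components of u have preimages
of norm at most |u| + eps, which glue to a preimage of F u with the same bound.
Conversely, any preimage of F u pulls back to a preimage of u i, and pulling
back does not increase norms. *)
Lemma glue_isometry : exists F : normed_dsum (fun _ : I => Q) -> P,
  algebra_morphism F /\ forall u, `|F u| = `|u|.
Proof.
have pi_surj q : exists x, pi x = q.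
  by have [x [xq _]] := pi_lift q ltr01; exists x.
have [F [Fm Fi FE]] := glue_morphism pi_morphism rho_morphism pi_overlap
  pi_pullback rho_local pi_surj.
exists F; split=> // u; apply/eqP; rewrite eq_le; apply/andP; split.
  apply/ler_addgt0Pl => eps eps0.
  have [x xu] := choice (fun i => pi_lift (u i) eps0).
  have [||y [yu yM]] := represents_exists (x := x) (M := eps + `|u|) (u := u)
    pi_morphism pi_overlap.
  - exact: addr_ge0 (ltW eps0) (normr_ge0 u).
  - move=> i _; split; last exact: (xu i).1.
    rewrite (le_trans (ltW (xu i).2))// addrC lerD2l.
    exact: (ler_dsum_norm u i).
  - by rewrite (FE _ _ yu) (le_trans (rho_le _)).
apply: (@sup_range_le _ _ (fun i => `|u i|)) => // i.
apply/ler_addgt0Pl => eps eps0; have [y [yF yM]] := rho_lift (F u) eps0.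
have [w wu] := represents_total pi_morphism pi_overlap pi_surj u.
have <- : pi (pullback (e i) (val y)) = u i.
  have := @pi_pullback (y - w).
  rewrite (algebra_morphismB _ _ rho_morphism) yF (FE _ _ wu) subrr.
  move=> /(_ erefl i); rewrite [y - w]addrC -scaleN1r val_subalgD val_subalgZ.
  rewrite (pullback_morphism _).1 pi_morphism.1 wu.1 scaleN1r addrC => /eqP.
  by rewrite subr_eq0 => /eqP.
rewrite (le_trans (pi_le _))// (le_trans (ler_norm_pullback _ _))// addrC.
exact: ltW.
Qed.

End Isometric.

End Gluing.

(** * Sets of density zero *)

Section ZeroDensity.
Context {R : realType}.

Lemma density_seq_le_enum (A : set nat) (g : nat -> nat) (t n : nat) :
  (forall k, (k <= n)%N -> A k -> exists2 m, (m < t)%N & g m = k) ->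
  density_seq R A n <= t%:R / n.+1%:R.
Proof.
move=> Ag; rewrite /density_seq ler_wpM2r ?invr_ge0// ler_nat.
pose h (m : 'I_t) : 'I_n.+1 := inord (g m).
have <- : #|'I_t| = t by rewrite card_ord.
apply: leq_trans (leq_image_card h _).
apply/subset_leq_card/fintype.subsetP => k /asboolP Ak.
have [|m mt gm] := Ag k _ Ak; first by rewrite -ltnS.
apply/fintype.imageP; exists (Ordinal mt) => //.
by apply: val_inj; rewrite /h /= inordK gm// ltn_ord.
Qed.

Lemma upper_density_singleton (k : nat) : upper_density R [set k] = 0.
Proof.
apply/upper_density0P; apply: (squeeze_cvgr _ (cvg_cst 0) (@cvg_harmonic R)).
near=> n; rewrite density_seq_ge0/= -[n.+1%:R^-1]mul1r.
apply: (@density_seq_le_enum _ (fun=> k) 1 n) => _ _ ->.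
by exists 0%N.
Unshelve. all: by end_near. Qed.

(** If t is the integer square root of n, there are at most t + 1 squares among
0, ..., n, and (t + 1)^2 <= 4 (n + 1); so the square of the density up to n is
at most 4 / (n + 1). *)
Lemma upper_density_squares :
  upper_density R (range (fun m : nat => m ^ 2)%N) = 0.
Proof.
apply/upper_density0P/cvgr0Pnorm_le => eps eps0.
have e2 : 0 < eps ^+ 2 / 4 by rewrite divr_gt0 ?exprn_gt0.
have /cvgr0Pnorm_le /(_ _ e2) := @cvg_harmonic R.
apply: filterS => n /=; rewrite ger0_norm ?invr_ge0// => ne.
rewrite ger0_norm ?density_seq_ge0//.
have [t /andP[tn nt]] : exists t, (t ^ 2 <= n < t.+1 ^ 2)%N.
  elim: n {ne} => [|n [t /andP[tn nt]]]; first by exists 0%N.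
  have [nt1|nt1] := ltnP n.+1 (t.+1 ^ 2).
    by exists t; rewrite nt1 (leq_trans tn).
  exists t.+1; rewrite nt1/=; apply: leq_ltn_trans nt _.
  by rewrite ltn_exp2r.
apply: (le_trans (@density_seq_le_enum _ (fun m => m ^ 2)%N t.+1 n _)).
  move=> k kn [m _ mk]; exists m => //; move: kn; rewrite -mk => kn.
  by rewrite -(ltn_exp2r _ _ (isT : 0 < 2)%N); exact: leq_ltn_trans nt.
rewrite -(@ler_pXn2r _ 2) ?nnegrE ?divr_ge0 ?(ltW eps0)//.
rewrite expr_div_n; apply: (@le_trans _ _ (4 * n.+1%:R / n.+1%:R ^+ 2)).
  rewrite ler_wpM2r ?invr_ge0 ?exprn_ge0// -natrX -natrM ler_nat.
  by move: tn; rewrite -!mulnn; nia.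
rewrite expr2 invfM mulrA mulfK ?pnatr_eq0//.
by rewrite -ler_pdivlMl// mulrC.
Qed.

Lemma upper_density_setT : upper_density R [set: nat] <> 0.
Proof.
move/upper_density0P; rewrite (_ : density_seq R _ = cst 1); last first.
  apply/funext => n; rewrite /density_seq (_ : #|_| = n.+1) ?divff ?pnatr_eq0//.
  rewrite -[RHS]card_ord; apply: eq_card => k; rewrite !inE.
  exact: asboolT.
move=> /(cvg_lim (@Rhausdorff R)); rewrite lim_cst; last exact: Rhausdorff.
by move/eqP; rewrite oner_eq0.
Qed.

End ZeroDensity.

(** * The ideals d00 and d0 of bounded sequences *)

Section SequenceIdeals.
Context {R : realType}.

Lemma indicator_bounded T (A : set T) :
  exists M : R, forall t, `|(`[< A t >])%:R| <= M.
Proof. by exists 1 => t; case: `[< A t >]; rewrite /= ?normr1 ?normr0. Qed.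

Definition indicator T (A : set T) : bfun R T := mk_bfun (indicator_bounded A).

Lemma d00_sub_d0 : d00_set R `<=` d0_set R.
Proof.
move=> x x0 e e0; apply: upper_density0_subset x0 => k /= ex xk.
by move: ex; rewrite xk normr0 leNgt e0.
Qed.

Lemma d0_closed : closed (d0_set R).
Proof.
move=> x clx e e0; have e20 : 0 < e / 2 by rewrite divr_gt0.
have [y [y0]] := clx _ (nbhsx_ballx x _ e20); rewrite -ball_normE /= => xy.
apply: upper_density0_subset (y0 _ e20) => k /= ex.
have := le_lt_trans (ler_bfun_norm (x - y) k) xy.
rewrite -[_ k]/(x k - y k); have := ler_normD (x k - y k) (y k).
by rewrite subrK; lra.
Qed.

Lemma truncate (x : linf R) (e : R) : 0 <= e ->
  exists y : linf R, `|x - y| <= e /\ forall k, y k <> 0 -> e <= `|x k|.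
Proof.
move=> e0; exists (indicator [set k | e <= `|x k|] ** x); split.
  apply/ler_norm_bfunP => // k.
  rewrite -[_ k]/(x k - (`[< e <= `|x k| >])%:R * x k).
  case: asboolP => [|/negP]; first by rewrite mul1r subrr normr0.
  by rewrite -ltNge mul0r subr0 => /ltW.
move=> k; rewrite -[_ k]/((`[< e <= `|x k| >])%:R * x k).
by case: asboolP => //; rewrite mul0r.
Qed.

Lemma d00_dense : dense [set x : subalg (d0 R) | d00_set R (val x)].
Proof.
move=> O [x Ox] oO; have /nbhs_ballP[e /= e0 eO] := open_nbhs_nbhs (conj oO Ox).
have e20 : 0 < e / 2 by rewrite divr_gt0.
have [y [xy yx]] := truncate (val x) (ltW e20).
have dy : d00_set R y.
  have /= dx := set_mem (valP x).
  by apply: upper_density0_subset (dx _ e20) => k; exact: yx.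
have Dy : y \in (d0 R : set (linf R)) by apply/mem_set; exact: d00_sub_d0.
exists (exist (fun z => z \in (d0 R : set (linf R))) y Dy); split => //.
apply: eO; rewrite -ball_normE /= norm_subalg val_subalgD -scaleN1r val_subalgZ.
by rewrite scaleN1r (le_lt_trans xy)//; lra.
Qed.

Lemma d00_indicator (A : set nat) :
  upper_density R A = 0 -> d00_set R (indicator A).
Proof.
apply: upper_density0_subset => k /=.
by case: asboolP.
Qed.

(** The unit would be 1 at every k, by comparison with the indicator of the
singleton of k, and its level set at height 1 would be all of N. *)
Lemma not_unital_of_subset_d0 (D : subalgebra (linf R)) :
  d00_set R `<=` D -> (D : set (linf R)) `<=` d0_set R -> ~ unital (subalg D).
Proof.
move=> sD Ds [u uP].
have u1 k : val u k = 1.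
  have D1 : indicator [set k] \in (D : set (linf R)).
    by apply/mem_set/sD/d00_indicator/upper_density_singleton.
  have [/(congr1 val) + _] := uP (exist (fun z => z \in (D : set (linf R))) _ D1).
  move=> /(congr1 (fun z : linf R => z k)).
  by rewrite val_subalgM bfunME /= asboolT// mulr1.
apply: (@upper_density_setT R); have /Ds /(_ _ ltr01) := set_mem (valP u).
by apply: upper_density0_subset => k _ /=; rewrite u1 normr1.
Qed.

(** In this form membership in c0 is a condition on level sets, like membership in
d0, and so behaves well under pull-back along injections. *)
Lemma c0_finiteP (x : linf R) :
  c0_set R x <-> forall eps : R, 0 < eps -> finite_set [set k | eps <= `|x k|].
Proof.
split=> [/cvgr0Pnorm_lt x0 eps eps0|xf].
  have [N _ NP] := x0 _ eps0.
  apply: sub_finite_set (finite_II N) => k /= ek; rewrite ltnNge; apply/negP => Nk.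
  by have := NP k Nk; rewrite /= ltNge ek.
apply/cvgr0Pnorm_lt => eps /xf /finite_seqP[s sP].
exists (\max_(k <- s) k).+1 => // k /= sk; rewrite ltNge; apply/negP => ek.
have /= ks : [set` s] k by rewrite -sP.
by move: sk; rewrite ltnNge (@leq_bigmax_seq _ s xpredT id k ks isT).
Qed.

Lemma c00_sub_c0 : c00_set R `<=` c0_set R.
Proof.
move=> x fx; apply/c0_finiteP => eps eps0; apply: sub_finite_set fx => k /= ex xk.
by move: ex; rewrite xk normr0 leNgt eps0.
Qed.

End SequenceIdeals.

(** * Copies of direct sums *)

Section AlmostDisjoint.
Variables (I : Type) (e : I -> nat -> nat).
Hypothesis e_inj : forall i, injective (e i).
Hypothesis e_disj : forall i j, i <> j -> finite_set (e i @^-1` range (e j)).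

Lemma finite_overlap J i : finite_set J -> ~ J i ->
  finite_set (e i @^-1` blocks e J).
Proof.
move=> fJ Ji; rewrite /blocks preimage_bigcup; apply: bigcup_finite => // j Jj.
by apply: e_disj => ij; subst j.
Qed.

Lemma finite_in_blocks J (S : set nat) : finite_set J -> S `<=` blocks e J ->
  (forall i, finite_set (e i @^-1` S)) -> finite_set S.
Proof.
move=> fJ SJ Sf; apply: (@sub_finite_set _ _ (\bigcup_(i in J) e i @` (e i @^-1` S))).
  by move=> k Sk; have [i Ji [n _ en]] := SJ k Sk; exists i => //;
    exists n => //=; rewrite en.
by apply: bigcup_finite => // i _; exact: finite_image.
Qed.

Lemma finite_preimage_block i (S : set nat) :
  finite_set S -> finite_set (e i @^-1` S).
Proof. by apply: finite_preimage => m n _ _; exact: e_inj. Qed.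

End AlmostDisjoint.

Section Copies.
Context {R : realType}.

Lemma qproj_morphism (A : nuAlgType R) (K : ideal A) : algebra_morphism (qproj K).
Proof. by split=> [a x y|x y]; rewrite ?qprojD ?qprojZ ?qprojM. Qed.

Lemma qproj_eq0P (A : nuAlgType R) (K : ideal A) x : qproj K x = 0 <-> ideal_set K x.
Proof. by rewrite -(qproj0 K) qprojP subr0. Qed.

Section Blocks.
Variables (I : Type) (e : I -> nat -> nat).
Hypothesis e_inj : forall i, injective (e i).
Hypothesis e_density : upper_density R (\bigcup_i range (e i)) = 0.

Lemma blocks_d00 J (y : linf R) : finite_set J ->
  (forall k, y k <> 0 -> blocks e J k) -> d00_set R y.
Proof.
move=> _ yJ; apply: upper_density0_subset e_density => k /yJ[i _ ki].
by exists i.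
Qed.

Lemma d00_disjoint_copy :
  (forall i j, i <> j -> e i @^-1` range (e j) = set0) ->
  contains_normed_copy (subalg (d00 R)) (normed_dsum (fun _ : I => linf R)).
Proof.
move=> e_disj.
have [||||||||| F [Fm FN]] := @glue_isometry R I e e_inj (d00 R) blocks_d00
    (linf R) (subalg (d00 R)) id id.
- by [].
- by [].
- move=> J i z _ Ji zJ; apply: bfunE => n; apply: contra_notP Ji.
  move=> /zJ[j Jj ji]; apply: contrapT => nJi.
  have ij : i <> j by move=> ij; subst j.
  have : (e i @^-1` range (e j)) n by exact: ji.
  by rewrite e_disj.
- by move=> y -> i; apply: bfunE => n.
- move=> J y _ yJ y0; apply: val_inj; apply: bfunE => k; apply: contrapT => yk.
  have [i _ [n _ en]] := yJ k yk; apply: yk.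
  by rewrite -en; have := congr1 (fun z : linf R => z n) (y0 i).
- by [].
- by [].
- by move=> x eps eps0; exists x; rewrite ltrDl.
- by move=> x eps eps0; exists x; rewrite ltrDl.
exact: isometric_contains_normed_copy FN.
Qed.

Hypothesis e_disj : forall i j, i <> j -> finite_set (e i @^-1` range (e j)).

Lemma d00_mod_c00_copy :
  contains_copy (quot_alg (restrict_ideal (d00 R) (c00 R)))
    (dsum (fun _ : I => quot_alg (c00 R))).
Proof.
have [|||||| F [Fm Fi _]] := @glue_morphism R I e e_inj (d00 R) blocks_d00
    (quot_alg (c00 R)) (quot_alg (restrict_ideal (d00 R) (c00 R)))
    (qproj _) (qproj _).
- exact: qproj_morphism.
- exact: qproj_morphism.
- move=> J i z fJ Ji zJ; apply/qproj_eq0P.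
  exact: sub_finite_set (finite_overlap e_disj fJ Ji).
- move=> y /qproj_eq0P y0 i; apply/qproj_eq0P.
  exact: (finite_preimage_block e_inj i y0).
- move=> J y fJ yJ y0; apply/qproj_eq0P; apply: (finite_in_blocks fJ yJ) => i.
  by have /qproj_eq0P := y0 i.
- by move=> q; have [x] := qproj_surj q; exists x.
exact: injective_contains_copy Fi.
Qed.

Lemma d0_mod_c0_copy :
  contains_normed_copy (quot_alg (restrict_closed_ideal (d0 R) (c0 R)))
    (normed_dsum (fun _ : I => quot_alg (c0 R))).
Proof.
have blocks_d0 J y fJ yJ : d0_set R y := d00_sub_d0 (@blocks_d00 J y fJ yJ).
have [||||||||| F [Fm FN]] := @glue_isometry R I e e_inj (d0 R) blocks_d0
    (quot_alg (c0 R)) (quot_alg (restrict_closed_ideal (d0 R) (c0 R)))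
    (qproj _) (qproj _).
- exact: qproj_morphism.
- exact: qproj_morphism.
- move=> J i z fJ Ji zJ; apply/qproj_eq0P; apply: c00_sub_c0.
  exact: sub_finite_set (finite_overlap e_disj fJ Ji).
- move=> y /qproj_eq0P /c0_finiteP y0 i; apply/qproj_eq0P/c0_finiteP => eps eps0.
  exact: (finite_preimage_block e_inj i (y0 _ eps0)).
- move=> J y fJ yJ y0; apply/qproj_eq0P/c0_finiteP => eps eps0.
  apply: (finite_in_blocks (e := e) fJ).
    move=> k /= ek; apply: yJ => yk.
    by move: ek; rewrite yk normr0 leNgt eps0.
  by move=> i; have /qproj_eq0P /c0_finiteP := y0 i; exact.
- exact: quot_norm_le.
- exact: quot_norm_le.
- exact: quot_norm_lt.
- exact: quot_norm_lt.
exact: isometric_contains_normed_copy FN.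
Qed.

End Blocks.

(** Squaring an injective code puts all blocks inside a fixed set of density zero,
whatever the number of blocks. *)
Definition square_code (T : countType) (s : T) : nat := (pickle s ^ 2)%N.

Lemma square_code_inj (T : countType) : injective (@square_code T).
Proof.
move=> s t /eqP; rewrite /square_code eqn_exp2r// => /eqP.
exact: (pcan_inj (@pickleK T)).
Qed.

Lemma square_code_density (T : countType) (I : Type) (s : I -> nat -> T) :
  upper_density R (\bigcup_i range (fun n => square_code (s i n))) = 0.
Proof.
apply: upper_density0_subset upper_density_squares => _ [i _ [n _ <-]].
by exists (pickle (s i n)).
Qed.

Definition row_block (i n : nat) : nat := square_code (i, n).

Lemma row_block_inj i : injective (row_block i).
Proof. by move=> m n /square_code_inj[]. Qed.

Lemma row_block_disjoint i j : i <> j ->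
  row_block i @^-1` range (row_block j) = set0.
Proof.
by move=> ij; rewrite -subset0 => n [m _ /square_code_inj[]] /esym.
Qed.

(** The branches of the binary tree give continuum many almost disjoint sets:
[branch_block b] enumerates codes of the finite initial segments of b. *)
Definition branch_block (b : nat -> bool) (n : nat) : nat :=
  square_code (mkseq b n).

Lemma branch_block_eq b c m n : branch_block b m = branch_block c n ->
  m = n /\ forall k, (k < n)%N -> b k = c k.
Proof.
move=> /square_code_inj mn.
have := congr1 size mn; rewrite !size_mkseq => mn'; subst m; split => // k kn.
by have := congr1 (fun s => nth false s k) mn; rewrite !nth_mkseq.
Qed.

Lemma branch_block_inj b : injective (branch_block b).
Proof. by move=> m n /branch_block_eq[]. Qed.

Lemma branch_block_almost_disjoint b c : b <> c ->
  finite_set (branch_block b @^-1` range (branch_block c)).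
Proof.
move=> bc; have [k bck] : exists k, b k <> c k.
  by apply/existsNP => bc'; apply: bc; exact/funext.
apply: sub_finite_set (finite_II k.+1) => n [m _ /branch_block_eq[_ cb]] /=.
by rewrite ltnS leqNgt; apply/negP => /cb /esym.
Qed.

End Copies.

(** * The algebras of continuous functions on the part of beta N covered by small sets *)

Section DenseSequence.
Context {R : realType} {T : topologicalType}.
Variable i : nat -> T.
Hypothesis i_dense : forall (t : T) (U : set T), nbhs t U -> exists n, U (i n).

Lemma linear_comb_continuous (a : R) (f g : T -> R) :
  continuous f -> continuous g -> continuous (fun t => a * f t + g t).
Proof. by move=> cf cg t; apply: cvgD; [apply: cvgZr; exact: cf|exact: cg]. Qed.

Lemma product_continuous (f g : T -> R) :
  continuous f -> continuous g -> continuous (fun t => f t * g t).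
Proof. by move=> cf cg t; apply: cvgM; [exact: cf|exact: cg]. Qed.

Lemma eq_continuous_dense (f g : T -> R) : continuous f -> continuous g ->
  (forall n, f (i n) = g (i n)) -> f = g.
Proof.
move=> cf cg fg; apply/funext => t; apply/eqP; rewrite -subr_eq0; apply/negP => /negP fgt.
have [n /=] : exists n, [set s | 0 < `|f s - g s|] (i n).
  apply: (i_dense (t := t)); apply: open_nbhs_nbhs; split; last by rewrite /= normr_gt0.
  apply: (@open_comp _ _ (fun s => `|f s - g s|) [set z | 0 < z]); last exact: open_gt.
  move=> s _; apply: (@continuous_comp _ _ _ (fun s => f s - g s) (fun z : R => `|z|)).
    by apply: cvgB; [exact: cf|exact: cg].
  exact: norm_continuous.
by rewrite fg subrr normr0 ltxx.
Qed.

End DenseSequence.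

Lemma compact_set_type (T : topologicalType) (Y C : set T) :
  C `<=` Y -> compact C -> compact (@set_val T Y @^-1` C).
Proof.
move=> CY kC F FF FC.
have [|p [Cp clp]] := kC (@set_val T Y @ F) _; first exact: FC.
exists (exist (fun p => p \in Y) p (mem_set (CY p Cp))); split => //.
move=> A U FA [_ [[W oW <-]] /= Wp WU].
have [||_ [[q Aq <-] Wq]] := clp (@set_val T Y @` A) W.
- by apply: (@filterS _ F _ A) FA => q Aq; exists q.
- exact: open_nbhs_nbhs.
- by exists q; split => //; exact: WU.
Qed.

Section BetaN.
Context {R : realType}.
Local Notation betaN := (betaN R).
Local Notation betaN_of := (@betaN_of R).
Implicit Types (x y : linf R) (A : set nat) (p : betaN).

(** The extension of x to the Stone-Cech compactification is a coordinate
projection, points of the latter being families indexed by the bounded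
sequences. *)
Definition extend x p : R := betaN_val p x.

Lemma extend_continuous x : continuous (extend x).
Proof. exact: betaN_coord_continuous. Qed.

Lemma extend_norm_continuous x : continuous (fun p => `|extend x p|).
Proof.
move=> p; apply: (@continuous_comp _ _ _ (extend x) (fun z : R => `|z|)).
  exact: extend_continuous.
exact: norm_continuous.
Qed.

Lemma betaN_of_dense p U : nbhs p U -> exists n, U (betaN_of n).
Proof.
rewrite nbhsE => -[O [oO Op] OU].
have [_ _ dN _ _] := betaN_is_stone_cech R.
have [|q [Oq [n _ nq]]] := dN O _ oO; first by exists p.
by exists n; apply: OU; rewrite nq.
Qed.

Lemma extendL (a : R) x y p :
  extend (a *: x + y) p = a * extend x p + extend y p.
Proof.
have -> // : extend (a *: x + y) = (fun p => a * extend x p + extend y p).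
apply: (eq_continuous_dense betaN_of_dense) => //.
  exact: extend_continuous.
by apply: linear_comb_continuous; exact: extend_continuous.
Qed.

Lemma extendM x y p : extend (x ** y) p = extend x p * extend y p.
Proof.
have -> // : extend (x ** y) = (fun p => extend x p * extend y p).
apply: (eq_continuous_dense betaN_of_dense) => //.
  exact: extend_continuous.
by apply: product_continuous; exact: extend_continuous.
Qed.

Lemma open_extend_gt x (c : R) : open [set p | c < `|extend x p|].
Proof.
apply: (@open_comp _ _ (fun p => `|extend x p|) [set z | c < z]).
  by move=> p _; exact: extend_norm_continuous.
exact: open_gt.
Qed.

Lemma ler_norm_extend x p : `|extend x p| <= `|x|.
Proof.
rewrite leNgt; apply/negP => xp.
have [n /=] := betaN_of_dense (open_nbhs_nbhs (conj (open_extend_gt x `|x|) xp)).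
by apply/negP; rewrite -leNgt; exact: (ler_bfun_norm x n).
Qed.

(** The points where the extension of x exceeds c in absolute value form a
neighbourhood of p; integers being dense, it meets every neighbourhood of p in
an integer, which must lie in A. *)
Lemma closure_of_extend_gt x A (c : R) p : (forall n, c < `|x n| -> A n) ->
  c < `|extend x p| -> closure (betaN_of @` A) p.
Proof.
move=> xA xp U nU.
have [n [/= xn Un]] := betaN_of_dense
  (filterI (open_nbhs_nbhs (conj (open_extend_gt x c) xp)) nU).
by exists (betaN_of n); split=> //; exists n => //; exact: xA.
Qed.

(** The extension of the indicator of A only takes the values 0 and 1, so any
threshold in between exhibits the closure of A both as an open set and as a
closed one. *)
Lemma closure_betaN_ofP A p :
  closure (betaN_of @` A) p <-> 2^-1 < `|extend (indicator A) p|.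
Proof.
split=> [clA|]; last first.
  apply: closure_of_extend_gt => n /=; case: asboolP => // _.
  by rewrite normr0 ltNge invr_ge0 ler0n.
suff : [set q | 1 <= `|extend (indicator A) q|] p.
  by apply: lt_le_trans; rewrite invf_lt1 ?ltr1n.
have cl : closed [set q : betaN | 1 <= `|extend (indicator A) q|].
  exact/closed_norm_ge/extend_continuous.
apply: cl; apply: closureS clA => _ [n An <-] /=.
by rewrite /extend /= asboolT// normr1.
Qed.

Lemma open_closure_betaN_of A : open (closure (betaN_of @` A)).
Proof.
rewrite (_ : closure _ = [set p | 2^-1 < `|extend (indicator A) p|]).
  exact: open_extend_gt.
by apply/seteqP; split=> p /closure_betaN_ofP.
Qed.

Lemma closure_betaN_of_nat A n : closure (betaN_of @` A) (betaN_of n) -> A n.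
Proof.
move/closure_betaN_ofP; rewrite /extend /=; case: asboolP => // _.
by rewrite normr0 ltNge invr_ge0 ler0n.
Qed.

Local Notation Y := (set_type (density0_union R)).

Definition closureY (A : set nat) : set Y :=
  @set_val _ (density0_union R) @^-1` closure (betaN_of @` A).

Lemma density0_union_of n : betaN_of n \in density0_union R.
Proof.
apply/mem_set; exists [set n]; first exact: upper_density_singleton.
by apply: subset_closure; exists n.
Qed.

Definition Y_of (n : nat) : Y :=
  exist (fun p => p \in density0_union R) (betaN_of n) (density0_union_of n).

Lemma Y_of_dense (t : Y) U : nbhs t U -> exists n, U (Y_of n).
Proof.
move=> [_ [[W oW <-]] /= Wt WU].
have [n Wn] := betaN_of_dense (open_nbhs_nbhs (conj oW Wt)).
by exists n; apply: WU.
Qed.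

Lemma set_val_continuous : continuous (@set_val _ (density0_union R)).
Proof. exact: initial_continuous. Qed.

Lemma closed_closureY A : closed (closureY A).
Proof.
apply: preimage_closed; last exact: closed_closure.
by move=> t _; exact: set_val_continuous.
Qed.

Lemma compact_closureY A : upper_density R A = 0 -> compact (closureY A).
Proof.
move=> A0; apply: compact_set_type; first by move=> p Ap; exists A.
by apply: (subclosed_compact (@closed_closure _ _) (compact_betaN (R := R))).
Qed.

(** Otherwise the sets K minus cl A, for A of density zero, form a proper filter
base, the family of the cl A being directed.  A cluster point of it in K
would lie in some cl A, which is an open set missing K minus cl A. *)
Lemma compact_sub_closureY (K : set Y) : compact K ->
  exists2 A, upper_density R A = 0 & K `<=` closureY A.
Proof.
move=> kK; apply: contrapT => nA.
pose F : set_system Y := filter_from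
  [set A | upper_density R A = 0] (fun A => K `\` closureY A).
have FF : ProperFilter F.
  apply: filter_from_proper.
    apply: filter_from_filter; first by exists set0; exact: upper_density_set0.
    move=> A B A0 B0; exists (A `|` B); first exact: upper_density0U.
    move=> t [Kt ABt]; split; split=> // tA; apply: ABt; apply: closureS tA;
      apply: image_subset; [exact: subsetUl|exact: subsetUr].
  move=> A A0; apply/set0P/eqP => KA; apply: nA; exists A => // t Kt.
  apply: contrapT => tA; suff : set0 t by [].
  by rewrite -KA.
have [|t [Kt clt]] := kK F FF.
  by exists set0; [exact: upper_density_set0|move=> t []].
have [A A0 tA] : density0_union R (set_val t) := set_mem (valP t).
have nA' : nbhs t (closureY A).
  exact: set_val_continuous (open_nbhs_nbhs (conj (open_closure_betaN_of A) tA)).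
have FA : F (K `\` closureY A) by exists A.
by have [t' [[_ ntA] /ntA]] := clt _ _ FA nA'.
Qed.

Lemma to_Y_bounded x : exists M, forall t : Y, `|extend x (set_val t)| <= M.
Proof. by exists `|x| => t; exact: ler_norm_extend. Qed.

Definition to_Y x : bfun R Y := mk_bfun (to_Y_bounded x).

Lemma from_Y_bounded (f : bfun R Y) : exists M, forall n, `|f (Y_of n)| <= M.
Proof. by have [M fM] := bfun_bounded f; exists M. Qed.

Definition from_Y (f : bfun R Y) : linf R := mk_bfun (from_Y_bounded f).

Lemma to_Y_continuous x : continuous (to_Y x : Y -> R).
Proof.
move=> t; apply: (@continuous_comp _ _ _ (@set_val _ (density0_union R)) (extend x)).
  exact: set_val_continuous.
exact: extend_continuous.
Qed.

Lemma to_YK : cancel to_Y from_Y.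
Proof. by move=> x; apply: bfunE => n. Qed.

Lemma from_YK (f : bfun R Y) : continuous (f : Y -> R) -> to_Y (from_Y f) = f.
Proof.
move=> cf; apply: bfunE => t; congr (_ t).
apply: (eq_continuous_dense Y_of_dense) => //; exact: to_Y_continuous.
Qed.

Lemma norm_to_Y x : `|to_Y x| = `|x|.
Proof.
apply/eqP; rewrite eq_le; apply/andP; split; apply/ler_norm_bfunP => // t.
  exact: ler_norm_extend.
exact: (ler_bfun_norm (to_Y x) (Y_of t)).
Qed.

Lemma to_Y_morphism : algebra_morphism to_Y.
Proof.
by split=> [a x y|x y]; apply: bfunE => t; [exact: extendL|exact: extendM].
Qed.

(** Reduces an identification of an algebra of sequences with one of continuous
functions on Y to the two inclusions. *)
Lemma to_Y_isometric_isomorphism (D : subalgebra (linf R))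
    (E : subalgebra (bfun R Y)) :
  (forall x, (D : set (linf R)) x -> (E : set (bfun R Y)) (to_Y x)) ->
  (forall f, (E : set (bfun R Y)) f ->
     continuous (f : Y -> R) /\ (D : set (linf R)) (from_Y f)) ->
  isometrically_isomorphic (subalg D) (subalg E).
Proof.
move=> DE ED.
pose G (s : subalg D) : subalg E := exist (fun z => z \in (E : set (bfun R Y)))
  (to_Y (val s)) (mem_set (DE _ (set_mem (valP s)))).
pose H (f : subalg E) : subalg D := exist (fun z => z \in (D : set (linf R)))
  (from_Y (val f)) (mem_set (ED _ (set_mem (valP f))).2).
exists G; split; last by move=> x; exact: norm_to_Y.
  split=> [a x y|x y]; apply: val_inj.
    rewrite val_subalgD val_subalgZ -[LHS]/(to_Y (val (a *: x + y))).
    by rewrite val_subalgD val_subalgZ to_Y_morphism.1.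
  rewrite val_subalgM -[LHS]/(to_Y (val (x ** y))).
  by rewrite val_subalgM to_Y_morphism.2.
exists H => [x|f]; apply: val_inj; first exact: to_YK.
by apply: from_YK; exact: (ED _ (set_mem (valP f))).1.
Qed.

(** The support of the extension of x lies in the closure of the support of x, and
the trace on N of a compact support is a set of density zero. *)
Lemma d00_C00 : isometrically_isomorphic (subalg (d00 R)) (subalg (C00 R Y)).
Proof.
apply: to_Y_isometric_isomorphism => [x x0|f [cf kf]].
  split; first exact: to_Y_continuous.
  apply: (subclosed_compact (@closed_closure _ _) (compact_closureY x0)).
  rewrite [X in _ `<=` X](closure_id _).1; last exact: closed_closureY.
  apply: closureS => t /= /eqP xt.
  apply: (@closure_of_extend_gt x _ 0); last by rewrite normr_gt0.
  by move=> n; rewrite normr_gt0 => /eqP.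
split=> //; have [A A0 fA] := compact_sub_closureY kf.
apply: upper_density0_subset A0 => n fn; apply: closure_betaN_of_nat.
exact/(fA (Y_of n))/subset_closure.
Qed.

(** The closed set where the extension of x is at least c in absolute value lies
in the closure of the set of the k with c / 2 <= |x k|; passing to c / 2 gives
the strict inequality that defines an open set. *)
Lemma d0_C0 : isometrically_isomorphic (subalg (d0 R)) (subalg (C0 R Y)).
Proof.
apply: to_Y_isometric_isomorphism => [x x0|f Cf].
  split; first exact: to_Y_continuous.
  move=> n; set c := n.+1%:R^-1.
  have c0 : 0 < c / 2 by rewrite divr_gt0// invr_gt0.
  apply: (subclosed_compact (closed_norm_ge _) (compact_closureY (x0 _ c0))).
    exact: to_Y_continuous.
  move=> t /= ct; apply: (@closure_of_extend_gt x _ (c / 2)) => [k /ltW //|].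
  by apply: lt_le_trans ct; lra.
split=> [|e e0]; first exact: Cf.1.
have [A A0 fA] := compact_sub_closureY (C0_compact Cf e0).
apply: upper_density0_subset A0 => n fn; apply: closure_betaN_of_nat.
exact/(fA (Y_of n)).
Qed.

End BetaN.

(** * Structure of d00 and d0 *)

Unset Implicit Arguments.

Theorem theorem4p4 (R : realType) :
  (* (1) *)
  (is_ideal (d00_set R) /\ (is_ideal (d0_set R) /\ closed (d0_set R))) /\
  (* (2) *)
  (d00_set R `<=` d0_set R /\
    dense [set x : subalg (d0 R) | d00_set R (val x)]) /\
  (* (3) *)
  (~ unital (subalg (d00 R)) /\ ~ unital (subalg (d0 R))) /\
  (* (4) *)
  (isometrically_isomorphic (subalg (d00 R))
     (subalg (C00 R (set_type (density0_union R)))) /\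
   isometrically_isomorphic (subalg (d0 R))
     (subalg (C0 R (set_type (density0_union R))))) /\
  (* (5) *)
  contains_normed_copy (subalg (d00 R)) (normed_dsum (fun _ : nat => linf R)) /\
  (* (6) *)
  (forall I : Type, ([set: I] #= [set: nat -> bool])%card ->
    contains_copy (quot_alg (restrict_ideal (d00 R) (c00 R)))
      (dsum (fun _ : I => quot_alg (c00 R)))) /\
  (* (7) *)
  (forall I : Type, ([set: I] #= [set: nat -> bool])%card ->
    contains_normed_copy (quot_alg (restrict_closed_ideal (d0 R) (c0 R)))
      (normed_dsum (fun _ : I => quot_alg (c0 R)))).
Proof.
split; first by split; [exact: d00_is_ideal|split; [exact: d0_is_ideal|exact: d0_closed]].
split; first by split; [exact: d00_sub_d0|exact: d00_dense].
split; first by split; apply: not_unital_of_subset_d0 => //; exact: d00_sub_d0.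
split; first by split; [exact: d00_C00|exact: d0_C0].
split.
  apply: (d00_disjoint_copy (e := row_block)).
  - exact: row_block_inj.
  - exact: square_code_density.
  - exact: row_block_disjoint.
have branches (I : Type) : ([set: I] #= [set: nat -> bool])%card ->
    exists b : I -> nat -> bool, injective b.
  move=> /card_set_bijP[b [_ bI _]]; exists b => i j.
  by apply: bI; rewrite inE.
split=> I /branches[b b_inj].
  apply: (d00_mod_c00_copy (e := fun i => branch_block (b i))) => [i||i j ij].
  - exact: branch_block_inj.
  - exact: square_code_density.
  - by apply: branch_block_almost_disjoint => /b_inj.
apply: (d0_mod_c0_copy (e := fun i => branch_block (b i))) => [i||i j ij].
- exact: branch_block_inj.
- exact: square_code_density.
- by apply: branch_block_almost_disjoint => /b_inj.
Qed.
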